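(* Let $M$ be a complete finite-dimensional Riemannian manifold and $S\subseteq M$ a closed locally convex subset. Then there exists an open set $W\subseteq M$ containing $S$ such that $\mathrm{proj}_S$ is a single-valued continuous mapping on $W$.
   Context: $d$ is the Riemannian distance; $d_S(y)=\inf\{d(z,y):z\in S\}$; $\mathrm{proj}_S\,y=\{z\in S:d(z,y)=d_S(y)\}$, and single-valued on $W$ means that this set is a singleton for every $y\in W$; $B(x,r)$ is the open metric ball. A subset $A\subseteq M$ is convex if for all $x,y\in A$ there exists a unique minimizing geodesic from $x$ to $y$ lying entirely in $A$. The convexity radius $r(x)$ of $M$ at $x$ is the supremum of all $r>0$ such that any metric ball in $B(x,r)$ is convex and any geodesic segment in $B(x,r)$ is a minimal geodesic joining its endpoints. A closed set $S$ is locally convex if for every $x\in S$ there is $0<\varepsilon(x)\le r(x)$ such that $S\cap B(x,\varepsilon(x))$ is convex. *)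

(* Defs.v *)
(* Riemannian manifolds and their convex subsets, on top of MathComp-Analysis. *)
From HB Require Import structures.
From mathcomp Require Import all_boot all_order all_algebra.
From mathcomp Require Import all_classical all_reals all_analysis.
Import Order.TTheory GRing.Theory Num.Theory.
Import numFieldNormedType.Exports.

Set Implicit Arguments.
Unset Strict Implicit.
Unset Printing Implicit Defensive.

Local Open Scope classical_set_scope.
Local Open Scope ring_scope.

(* [U] is meant to be open: the derivatives below are two-sided. *)
Fixpoint Ck (R : realType) (V W : normedModType R) (k : nat)
    (U : set V) (f : V -> W) : Prop :=
  if k is k'.+1 then
    (forall x, U x -> differentiable f x) /\
    (forall v : V, Ck k' U (fun x => 'D_v f x))
  else forall x, U x -> {for x, continuous f}.

Definition Cinfty (R : realType) (V W : normedModType R)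
    (U : set V) (f : V -> W) : Prop := forall k, Ck k U f.

(* A smooth structure of dimension [n] on the space [M].  [chart_inv i] is only
   meaningful on [chart i @` dom i], and [chart_at x] is a preferred chart
   around [x].  Neither connectedness nor second countability is assumed. *)
Record smooth_structure (R : realType) (n : nat) (M : topologicalType) := {
  chart_index : Type ;
  dom : chart_index -> set M ;
  chart : chart_index -> M -> 'rV[R]_n ;
  chart_inv : chart_index -> 'rV[R]_n -> M ;
  chart_at : M -> chart_index ;
  chart_atP : forall x, dom (chart_at x) x ;
  dom_open : forall i, open (dom i) ;
  codom_open : forall i, open (chart i @` dom i) ;
  chartK : forall i x, dom i x -> chart_inv i (chart i x) = x ;
  chart_continuous : forall i x, dom i x -> {for x, continuous (chart i)} ;
  chart_inv_continuous : forall i x, dom i x ->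
    {for chart i x, continuous (chart_inv i)} ;
  transition_smooth : forall i j,
    Cinfty (chart i @` (dom i `&` dom j)) (chart j \o chart_inv i)
}.

(* [gram i p] is the Gram matrix of the inner product at the point of
   coordinates [p] in the chart [i]; tangent vectors are row vectors. *)
Record riemannian_manifold (R : realType) (n : nat) (M : topologicalType) := {
  structure :> smooth_structure R n M ;
  manifold_hausdorff : hausdorff_space M ;
  gram : chart_index structure -> 'rV[R]_n -> 'M[R]_n ;
  gram_sym : forall i x, dom i x ->
    (gram i (chart i x))^T = gram i (chart i x) ;
  gram_pos : forall i x, dom i x -> forall v : 'rV[R]_n, v != 0 ->
    0 < (v *m gram i (chart i x) *m v^T) 0 0 ;
  gram_smooth : forall i, Cinfty (chart i @` dom i) (gram i) ;
  gram_compat : forall i j x, dom i x -> dom j x -> forall u v : 'rV[R]_n,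
    let D w := 'D_w (chart j \o chart_inv i) (chart i x) in
    u *m gram i (chart i x) *m v^T = D u *m gram j (chart j x) *m (D v)^T
}.

Section Riemannian.
Context (R : realType) (n : nat) (M : topologicalType).
Variable G : riemannian_manifold R n M.
Implicit Types (x y z : M) (A S : set M) (c : R -> M) (t : R).

Definition coords c t : R -> 'rV[R]_n := chart (chart_at G (c t)) \o c.

Definition gram_at x : 'M[R]_n := gram (chart_at G x) (chart (chart_at G x) x).

Definition speed c t : R :=
  let v := derive1 (coords c t) t in Num.sqrt ((v *m gram_at (c t) *m v^T) 0 0).

Definition C1_at c t : Prop :=
  [/\ {for t, continuous c},
      \forall s \near t, derivable (coords c t) s 1 &
      {for t, continuous (derive1 (coords c t))}].

(* On each piece [c] agrees with a curve which is C^1 around every point of the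
   closed piece, endpoints included. *)
Definition piecewise_C1 c : Prop :=
  {within `[0, 1], continuous c} /\
  exists (N : nat) (t : nat -> R), [/\ t 0%N = 0, t N = 1 &
    forall k, (k < N)%N -> t k < t k.+1 /\
      exists b : R -> M, forall s, t k <= s <= t k.+1 -> C1_at b s /\ b s = c s].

(* All curves are parametrized by [0, 1]; [speed] is irrelevant at the finitely
   many break points. *)
Definition curve_length c : \bar R :=
  (\int[lebesgue_measure]_(t in `[0%R, 1%R]) (speed c t)%:E)%E.

(* Equal to +oo between distinct connected components. *)
Definition rdist x y : \bar R :=
  ereal_inf [set curve_length c |
    c in [set c | [/\ piecewise_C1 c, c 0 = x & c 1 = y]]].

Definition mball x (r : R) : set M := [set y | (rdist x y < r%:E)%E].

Definition complete_manifold : Prop :=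
  forall u : nat -> M,
    (forall e : R, 0 < e -> exists N, forall p q, (N <= p)%N -> (N <= q)%N ->
       (rdist (u p) (u q) < e%:E)%E) ->
    exists x, forall e : R, 0 < e -> exists N, forall p, (N <= p)%N ->
       (rdist (u p) x < e%:E)%E.

Definition christoffel (i : chart_index G) (k a b : 'I_n) (p : 'rV[R]_n) : R :=
  let d (j h l : 'I_n) := 'D_(delta_mx 0 j) (fun q => gram i q h l) p in
  2^-1 * \sum_l invmx (gram i p) k l * (d a b l + d b a l - d l a b).

(* The geodesic equation at time [t], in the preferred chart at [c t]. *)
Definition geodesic_at c t : Prop :=
  let g := coords c t in
  [/\ {for t, continuous c},
      \forall s \near t, derivable g s 1,
      derivable (derive1 g) t 1 &
      forall k : 'I_n,
        derive1 (derive1 g) t 0 k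
        + \sum_a \sum_b christoffel (chart_at G (c t)) k a b (g t)
            * derive1 g t 0 a * derive1 g t 0 b = 0].

(* Only the values of [c] on [0, 1] matter; the equation is imposed up to the
   endpoints, where [c] is extended beyond the segment. *)
Definition geodesic c : Prop := forall t, 0 <= t <= 1 -> geodesic_at c t.

Definition minimal_geodesic x y c : Prop :=
  [/\ geodesic c, c 0 = x, c 1 = y & curve_length c = rdist x y].

(* Uniqueness is among the minimizing geodesics which lie in [A]. *)
Definition convex_subset A : Prop := forall x y, A x -> A y ->
  let P c := minimal_geodesic x y c /\ c @` `[0, 1] `<=` A in
  exists2 c, P c & forall c', P c' -> {in `[0, 1], c' =1 c}.

Definition convexity_radius x : \bar R :=
  ereal_sup [set r%:E | r in [set r : R | [/\ 0 < r,
    forall y (s : R), 0 < s -> mball y s `<=` mball x r ->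
      convex_subset (mball y s) &
    forall c, geodesic c -> c @` `[0, 1] `<=` mball x r ->
      minimal_geodesic (c 0) (c 1) c]]].

Definition locally_convex_subset S : Prop := forall x, S x ->
  exists e : R, [/\ 0 < e, (e%:E <= convexity_radius x)%E &
    convex_subset (S `&` mball x e)].

Definition rdist_set S y : \bar R := ereal_inf [set rdist z y | z in S].

Definition metric_proj S y : set M := [set z | S z /\ rdist z y = rdist_set S y].

End Riemannian.

(* Main.v *)
Require Import Defs.
From mathcomp Require Import all_boot all_order all_algebra.
From mathcomp Require Import all_classical all_reals all_analysis.
From mathcomp Require Import measurable_realfun.
From mathcomp Require Import ring lra.
Import Order.TTheory GRing.Theory Num.Theory.
Import numFieldNormedType.Exports.
Local Open Scope classical_set_scope.
Local Open Scope ring_scope.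
Set Implicit Arguments.
Unset Strict Implicit.
Unset Printing Implicit Defensive.

(** Near a point of [S] everything is read in one chart, where points are row
vectors and the metric is a smooth field [g] of positive definite matrices.
Geodesics enter only through the energy: a minimizing geodesic has constant
speed, so its energy density is constantly the square of the distance of its
endpoints, while every [C1] curve has energy at least that square, by the
Cauchy-Schwarz inequality.  Thus a single test curve bounds a distance from
above.

The heart of the matter is that, close to the chosen point, the squared
distance to [y] is uniformly convex along the short geodesics of [S]: if [m] is
the middle of a minimizing geodesic joining [z1] to [z2], then
d(m, y)^2 <= (d(z1, y)^2 + d(z2, y)^2) / 2 - kappa |z2 - z1|^2
([midpoint_strict_convexity]).  The test curve is the average, in coordinates,
of the minimizing geodesics from [z1] and [z2] to [y]
([averaged_curve_energy]).  For a flat metric the parallelogram identity gives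
the gain; the metric is only nearly constant, but the resulting errors carry a
factor that tends to zero with the length of the curves.  This test curve starts
at the middle of the segment from [z1] to [z2] and not at [m].  The two differ
by O(|z2 - z1|^2), as comparing the geodesic with the segment shows
([minimizer_near_segment]), so correcting the endpoint costs only a small
multiple of |z2 - z1|^2.

Local convexity of [S] puts [m] into [S].  If [z1] is a point of [S] nearest to
[y], the inequality becomes quadratic growth,
d(z, y)^2 >= d(z1, y)^2 + 2 kappa |z - z1|^2 for [z] in [S]
([minimizes_growth]).  This makes the nearest point unique, and, as d^2 is
Lipschitz in coordinates, it makes the projection Hoelder continuous of
exponent 1/2 ([minimizes_holder]).  The nearest point exists by compactness of
small closed balls.

What allows working in a chart is that short curves starting near its center
do not leave it ([chart_localization]): a bump function supported in the chart
varies along a curve by at most a constant times the length. *)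

(** * Integrals of continuous functions on an interval *)

Section IntegralsOfContinuousFunctions.
Variable R : realType.
Local Notation mu := (@lebesgue_measure R).
Implicit Types (f g h F : R -> R) (a b s t : R).

Definition cont_on (T : topologicalType) a b (f : R -> T) :=
  forall t, a <= t <= b -> {for t, continuous f}.

Lemma cont_on_within (T : topologicalType) a b (f : R -> T) :
  cont_on a b f -> {within `[a, b], continuous f}.
Proof.
move=> cf; apply: continuous_in_subspaceT => t /set_mem /=.
by rewrite in_itv /=; exact: cf.
Qed.

Lemma cont_on_sub (T : topologicalType) a b s t (f : R -> T) :
  a <= s -> t <= b -> cont_on a b f -> cont_on s t f.
Proof.
move=> as_ tb cf u /andP[su ut]; apply: cf.
by rewrite (le_trans as_ su) (le_trans ut tb).
Qed.

Lemma cont_on_integrable a b f :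
  cont_on a b f -> mu.-integrable `[a, b] (EFin \o f).
Proof.
move=> /cont_on_within cf.
by apply: continuous_compact_integrable => //; exact: segment_compact.
Qed.

Lemma cont_on_measurable a b f :
  cont_on a b f -> measurable_fun `[a, b] f.
Proof. by move/cont_on_integrable => /integrableP[/measurable_EFinP]. Qed.

Lemma integral_derive a b F f : a <= b ->
  (forall t, a <= t <= b -> is_derive t 1 F (f t)) -> cont_on a b f ->
  (\int[mu]_(t in `[a, b]) (f t)%:E = (F b - F a)%:E)%E.
Proof.
rewrite le_eqVlt => /predU1P[<- _ _|ab dF cf].
  by rewrite set_itv1 integral_set1 subrr.
have cF : cont_on a b F.
  move=> t /dF[dt _]; apply: differentiable_continuous.
  exact/derivable1_diffP.
rewrite EFinB; apply: (continuous_FTC2 ab (cont_on_within cf)).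
  split.
  - by move=> t; rewrite in_itv /= => /andP[/ltW ? /ltW ?]; have [] := dF t _;
      rewrite // ?inE; apply/andP.
  - by apply: cvg_at_right_filter; apply: cF; rewrite lexx ltW.
  - by apply: cvg_at_left_filter; apply: cF; rewrite lexx ltW.
move=> t; rewrite in_itv /= => /andP[/ltW at_ /ltW tb].
by rewrite derive1E; have [|_ ->] := dF t; rewrite ?at_.
Qed.

Lemma increment_le_integral a b F f h : a <= b ->
  (forall t, a <= t <= b -> is_derive t 1 F (f t)) -> cont_on a b f ->
  cont_on a b h -> (forall t, a <= t <= b -> `|f t| <= h t) ->
  (`|F b - F a|%:E <= \int[mu]_(t in `[a, b]) (h t)%:E)%E.
Proof.
move=> ab dF cf ch fh.
rewrite -(abse_EFin (F b - F a)) -(integral_derive ab dF cf).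
have mf := (measurable_EFinP _ _).2 (cont_on_measurable cf).
apply: (le_trans (le_abse_integral mu _ mf)) => //.
apply: ge0_le_integral => //=.
- by do 2!apply: measurableT_comp => //; exact: (cont_on_measurable cf).
- by apply: measurableT_comp => //; exact: (cont_on_measurable ch).
Qed.

(** The interval has length one, so the integral is an average. *)
Definition mean f : R := (\int[mu]_(t in `[0, 1]) f t)%R.

Lemma mean_le f g : cont_on 0 1 f -> cont_on 0 1 g ->
  (forall t, 0 <= t <= 1 -> f t <= g t) -> mean f <= mean g.
Proof.
move=> cf cg fg; apply: le_Rintegral => //; try exact: cont_on_integrable.
Qed.

Lemma meanD f g : cont_on 0 1 f -> cont_on 0 1 g ->
  mean (fun t => f t + g t) = mean f + mean g.
Proof. by move=> cf cg; apply: RintegralD => //; exact: cont_on_integrable. Qed.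

Lemma meanZ (c : R) f : cont_on 0 1 f -> mean (fun t => c * f t) = c * mean f.
Proof. by move=> cf; apply: RintegralZl => //; exact: cont_on_integrable. Qed.

Lemma mean_cst (c : R) : mean (fun=> c) = c.
Proof.
rewrite /mean /Rintegral integral_cst//= lebesgue_measure_itv /= lte01.
by rewrite oppr0 adde0 mule1.
Qed.

Lemma cont_on_lin3 (A B C : R) f g h : cont_on 0 1 f -> cont_on 0 1 g ->
  cont_on 0 1 h -> cont_on 0 1 (fun t => A * f t + B * g t + C * h t).
Proof.
move=> cf cg ch t t01.
have Z (D : R) (u : R -> R) : cont_on 0 1 u -> {for t, continuous (fun t => D * u t)}.
  by move=> cu; apply: cvgM; [exact: cst_continuous|exact: cu].
by apply: cvgD; [apply: cvgD|]; exact: Z.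
Qed.

Lemma mean_lin3 (A B C : R) f g h : cont_on 0 1 f -> cont_on 0 1 g ->
  cont_on 0 1 h -> mean (fun t => A * f t + B * g t + C * h t) =
    A * mean f + B * mean g + C * mean h.
Proof.
move=> cf cg ch.
have Z (D : R) (u : R -> R) : cont_on 0 1 u -> cont_on 0 1 (fun t => D * u t).
  by move=> cu t t01; apply: cvgM; [exact: cst_continuous|exact: cu].
have AB : cont_on 0 1 (fun t => A * f t + B * g t).
  by move=> t t01; apply: cvgD; exact: Z.
by rewrite (meanD AB (Z _ _ ch)) (meanD (Z _ _ cf) (Z _ _ cg)) !meanZ.
Qed.

Lemma cont_on_cst (T : topologicalType) a b (x : T) : cont_on a b (fun=> x).
Proof. by move=> t _; exact: cst_continuous. Qed.

Lemma mean_eq f g : (forall t, 0 <= t <= 1 -> f t = g t) -> mean f = mean g.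
Proof.
move=> fg; apply: eq_Rintegral => t /set_mem /=.
by rewrite in_itv /=; exact: fg.
Qed.

Lemma mean_ge0 f : (forall t, 0 <= t <= 1 -> 0 <= f t) -> 0 <= mean f.
Proof. by move=> f0; apply: Rintegral_ge0 => t; rewrite /= in_itv; exact: f0. Qed.

Lemma EFin_mean f : cont_on 0 1 f ->
  ((mean f)%:E = \int[mu]_(t in `[0%R, 1%R]) (f t)%:E)%E.
Proof.
move=> cf; rewrite /mean /Rintegral fineK//.
by apply: integrable_fin_num => //; exact: cont_on_integrable.
Qed.

Lemma mean_derive F f :
  (forall t, 0 <= t <= 1 -> is_derive t 1 F (f t)) -> cont_on 0 1 f ->
  mean f = F 1 - F 0.
Proof. by move=> dF cf; rewrite /mean /Rintegral (integral_derive ler01 dF cf). Qed.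

Lemma cont_on_sqr f : cont_on 0 1 f -> cont_on 0 1 (fun t => f t ^+ 2).
Proof. by move=> cf t t01; exact: cvgM (cf t t01) (cf t t01). Qed.

(** The variance of [f] is nonnegative. *)
Lemma mean_sqr_ge f : cont_on 0 1 f -> mean f ^+ 2 <= mean (fun t => f t ^+ 2).
Proof.
move=> cf; set m := mean f.
have cf2 := cont_on_sqr cf.
have c1 : cont_on 0 1 (fun t => (- 2 * m) * f t).
  by move=> t t01; apply: cvgM; [exact: cvg_cst|exact: cf].
have cm : cont_on 0 1 (fun=> m ^+ 2) by move=> t _; exact: cvg_cst.
have c2 : cont_on 0 1 (fun t => (- 2 * m) * f t + m ^+ 2).
  by move=> t t01; apply: cvgD; [exact: c1|exact: cm].
have := mean_ge0 (f := fun t => f t ^+ 2 + ((- 2 * m) * f t + m ^+ 2)).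
rewrite (meanD cf2 c2) (meanD c1 cm) meanZ// mean_cst -/m.
have H t : 0 <= t <= 1 -> 0 <= f t ^+ 2 + (- 2 * m * f t + m ^+ 2).
  by move=> _; have := sqr_ge0 (f t - m); nra.
move=> /(_ H); nra.
Qed.

Lemma increment_le_mean s t F f h : 0 <= s <= 1 -> 0 <= t <= 1 ->
  (forall t, 0 <= t <= 1 -> is_derive t 1 F (f t)) -> cont_on 0 1 f ->
  cont_on 0 1 h -> (forall t, 0 <= t <= 1 -> `|f t| <= h t) ->
  `|F t - F s| <= mean h.
Proof.
wlog st : s t / s <= t.
  move=> H s01 t01 dF cf ch fh; have [/H|/ltW/H] := leP s t; first exact.
  by rewrite distrC; exact.
move=> /andP[s0 s1] /andP[t0 t1] dF cf ch fh.
have sub u : s <= u <= t -> 0 <= u <= 1.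
  by move=> /andP[su ut]; rewrite (le_trans s0 su) (le_trans ut t1).
rewrite -lee_fin EFin_mean//.
apply: (@le_trans _ _ (\int[mu]_(t in `[s, t]) (h t)%:E)%E).
  apply: (increment_le_integral st (f := f)) => [u /sub/dF//|||u /sub/fh//];
    exact: (cont_on_sub s0 t1).
apply: ge0_subset_integral => //=.
  by apply: measurableT_comp => //; exact: cont_on_measurable.
by move=> u; rewrite in_itv /= => /fh; rewrite lee_fin; apply: le_trans.
Qed.

End IntegralsOfContinuousFunctions.

(** * Bilinear forms and continuously differentiable curves *)

Section MatrixNorm.
Variable R : realType.

Lemma mx_coord_le m n (A : 'M[R]_(m, n)) i j : `|A i j| <= `|A|.
Proof.
rewrite [leRHS]/Num.Def.normr /= mx_normrE.
exact: (le_bigmax _ (fun ij : 'I_m * 'I_n => `|A ij.1 ij.2|) (i, j)).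
Qed.

Lemma mx_norm_le m n (A : 'M[R]_(m, n)) (c : R) : 0 <= c ->
  (forall i j, `|A i j| <= c) -> `|A| <= c.
Proof.
move=> c0 Ac; rewrite [leLHS]/Num.Def.normr /= mx_normrE.
by rewrite (bigmax_le _ c0)//= => -[i j] _; exact: Ac.
Qed.

Lemma cvg_sumr (V : normedModType R) (I T : Type) (F : set_system T)
    (FF : Filter F) (r : seq I) (f : I -> T -> V) (l : I -> V) :
  (forall i, f i x @[x --> F] --> l i) ->
  \sum_(i <- r) f i x @[x --> F] --> \sum_(i <- r) l i.
Proof. by move=> fl; apply: cvg_big => // -[x y]; exact: add_continuous. Qed.

Lemma cont_near_eq (T U : topologicalType) (f g : T -> U) t :
  (\forall s \near t, f s = g s) -> {for t, continuous g} ->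
  {for t, continuous f}.
Proof.
move=> fg cg; suff : f s @[s --> t] --> f t by [].
rewrite (nbhs_singleton fg); apply: cvg_trans cg.
by apply: near_eq_cvg; apply: filterS fg => s ->.
Qed.

Lemma cont_coord (T : topologicalType) m n (f : T -> 'M[R]_(m, n)) t i j :
  {for t, continuous f} -> {for t, continuous (fun s => f s i j)}.
Proof.
move=> cf; apply: (continuous_comp (f := f) (g := fun M : 'M[R]_(m, n) => M i j) cf).
exact: coord_continuous.
Qed.

End MatrixNorm.

Section BilinearForms.
Variables (R : realType) (n : nat).
Implicit Types (A B : 'M[R]_n) (u v w : 'rV[R]_n).

Definition bil A u v : R := (u *m A *m v^T) 0 0.

Lemma bilE A u v : bil A u v = \sum_a \sum_b u 0 a * A a b * v 0 b.
Proof.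
rewrite /bil mxE exchange_big /=; apply: eq_bigr => b _.
by rewrite !mxE mulr_suml.
Qed.

Lemma bilDl A u v w : bil A (u + v) w = bil A u w + bil A v w.
Proof. by rewrite /bil !mulmxDl mxE. Qed.
Lemma bilDr A u v w : bil A w (u + v) = bil A w u + bil A w v.
Proof. by rewrite /bil linearD mulmxDr mxE. Qed.
Lemma bilZl A c u w : bil A (c *: u) w = c * bil A u w.
Proof. by rewrite /bil -!scalemxAl mxE. Qed.
Lemma bilZr A c u w : bil A w (c *: u) = c * bil A w u.
Proof. by rewrite /bil linearZ /= -scalemxAr mxE. Qed.
Lemma bilNl A u w : bil A (- u) w = - bil A u w.
Proof. by rewrite -scaleN1r bilZl mulN1r. Qed.
Lemma bilNr A u w : bil A w (- u) = - bil A w u.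
Proof. by rewrite -scaleN1r bilZr mulN1r. Qed.
Lemma bilMD A B u v : bil (A + B) u v = bil A u v + bil B u v.
Proof. by rewrite /bil mulmxDr mulmxDl mxE. Qed.
Lemma bilMZ c A u v : bil (c *: A) u v = c * bil A u v.
Proof. by rewrite /bil -scalemxAr -scalemxAl mxE. Qed.
Lemma bilMN A u v : bil (- A) u v = - bil A u v.
Proof. by rewrite -scaleN1r bilMZ mulN1r. Qed.
Lemma bilMB A B u v : bil (A - B) u v = bil A u v - bil B u v.
Proof. by rewrite bilMD bilMN. Qed.

Lemma bilC A u v : A^T = A -> bil A u v = bil A v u.
Proof.
move=> At; rewrite !bilE exchange_big /=.
apply: eq_bigr => a _; apply: eq_bigr => b _.
by rewrite -[in LHS]At mxE; ring.
Qed.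

Lemma bil_norm A u v : `|bil A u v| <= (n ^ 2)%:R * `|A| * `|u| * `|v|.
Proof.
rewrite bilE (le_trans (ler_norm_sum _ _ _))//.
have -> : (n ^ 2)%:R * `|A| * `|u| * `|v| =
    \sum_(a < n) \sum_(b < n) (`|A| * `|u| * `|v|).
  by rewrite !sumr_const !card_ord -mulrnA mulnn -[RHS]mulr_natl !mulrA.
apply: ler_sum => a _; rewrite (le_trans (ler_norm_sum _ _ _))//.
apply: ler_sum => b _; rewrite !normrM [_ * `|A a b|]mulrC.
by rewrite !ler_pM// ?mulr_ge0// ?mx_coord_le.
Qed.

Lemma cont_bil (T : topologicalType) (A : T -> 'M[R]_n) (u v : T -> 'rV[R]_n) t :
  {for t, continuous A} -> {for t, continuous u} -> {for t, continuous v} ->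
  {for t, continuous (fun s => bil (A s) (u s) (v s))}.
Proof.
move=> cA cu cv; rewrite (_ : (fun s => _) =
    (fun s => \sum_a \sum_b u s 0 a * A s a b * v s 0 b)); last first.
  by apply/funext => s; rewrite bilE.
apply: (@cvg_sumr R R) => a; apply: (@cvg_sumr R R) => b.
apply: cvgM; last exact: cont_coord.
by apply: cvgM; exact: cont_coord.
Qed.

Lemma is_derive_coord (V : normedModType R) m k (f : V -> 'M[R]_(m, k)) (x v : V)
    (df : 'M[R]_(m, k)) i j : is_derive x v f df -> is_derive x v (fun s => f s i j) (df i j).
Proof.
move=> [fx <-]; have fij := (derivable_mxP f x v).1 fx i j.
by apply: DeriveDef => //; rewrite derive_mx// mxE.
Qed.

Lemma is_derive_bil (A : R -> 'M[R]_n) (u v : R -> 'rV[R]_n) (t : R)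
    (dA : 'M[R]_n) (du dv : 'rV[R]_n) :
  is_derive t 1 A dA -> is_derive t 1 u du -> is_derive t 1 v dv ->
  is_derive t 1 (fun s => bil (A s) (u s) (v s))
    (bil dA (u t) (v t) + bil (A t) du (v t) + bil (A t) (u t) dv).
Proof.
move=> hA hu hv.
rewrite (_ : (fun s => _) = \sum_a \sum_b
    ((fun s => u s 0 a) * (fun s => A s a b) * (fun s => v s 0 b))); last first.
  apply/funext => s; rewrite bilE fct_sumE; apply: eq_bigr => a _.
  by rewrite fct_sumE.
have hh a b : is_derive t 1
    ((fun s => u s 0 a) * (fun s => A s a b) * (fun s => v s 0 b))
    ((u t 0 a * A t a b) * dv 0 b
     + v t 0 b * (u t 0 a * dA a b + A t a b * du 0 a)).
  have ha := is_derive_coord 0 a hu; have hb := is_derive_coord 0 b hv.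
  have hab := is_derive_coord a b hA.
  exact: (is_deriveM (is_deriveM ha hab) hb).
apply: (is_derive_eq (is_derive_sum (fun a => is_derive_sum (hh a)))).
rewrite !bilE -!big_split /=; apply: eq_bigr => a _.
rewrite -!big_split /=; apply: eq_bigr => b _; ring.
Qed.

End BilinearForms.

Section C1Curves.
Variable R : realType.

Definition C1_pt (V : normedModType R) (f : R -> V) t :=
  (\forall s \near t, derivable f s 1) /\ {for t, continuous (derive1 f)}.

Definition C1_on (V : normedModType R) (f : R -> V) :=
  forall t, 0 <= t <= 1 -> C1_pt f t.

Section Basics.
Variable V : normedModType R.
Implicit Types (f g : R -> V) (t : R).

Lemma C1_pt_derivable f t : C1_pt f t -> derivable f t 1.
Proof. by case=> /nbhs_singleton. Qed.

Lemma C1_pt_is_derive f t : C1_pt f t -> is_derive t 1 f (derive1 f t).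
Proof. by move=> /C1_pt_derivable ?; rewrite derive1E; exact: DeriveDef. Qed.

Lemma derivable_cont f t : derivable f t 1 -> {for t, continuous f}.
Proof.
by move=> ?; apply: differentiable_continuous; exact/derivable1_diffP.
Qed.

Lemma is_derive1_val f t df : is_derive t 1 f df -> derive1 f t = df.
Proof. by move=> ?; rewrite derive1E derive_val. Qed.

Lemma C1_pt_cont f t : C1_pt f t -> {for t, continuous f}.
Proof. by move=> /C1_pt_derivable; exact: derivable_cont. Qed.

Lemma C1_pt_near f (df : R -> V) t :
  (\forall s \near t, is_derive (s : R) 1 f (df s)) -> {for t, continuous df} ->
  C1_pt f t.
Proof.
move=> hf cdf; split; first by apply: filterS hf => s [].
have e : \forall s \near t, derive1 f s = df s.
  by apply: filterS hf => s; exact: is_derive1_val.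
exact: cont_near_eq e cdf.
Qed.

Lemma C1_pt_near_is_derive f t : C1_pt f t ->
  \forall s \near t, is_derive (s : R) 1 f (derive1 f s).
Proof. by case=> h _; apply: filterS h => s ?; rewrite derive1E; exact: DeriveDef. Qed.

Lemma C1_ptD f g t : C1_pt f t -> C1_pt g t -> C1_pt (fun s => f s + g s) t.
Proof.
move=> hf hg; apply: (@C1_pt_near _ (fun s => derive1 f s + derive1 g s)).
  near=> s; apply: is_deriveD.
    by near: s; exact: C1_pt_near_is_derive.
  by near: s; exact: C1_pt_near_is_derive.
by apply: cvgD; [case: hf|case: hg].
Unshelve. all: by end_near. Qed.

Lemma C1_ptZ (c : R) f t : C1_pt f t -> C1_pt (fun s => c *: f s) t.
Proof.
move=> hf; apply: (@C1_pt_near _ (fun s => c *: derive1 f s)).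
  near=> s; apply: is_deriveZ.
  by near: s; exact: C1_pt_near_is_derive.
by apply: cvgZr; case: hf.
Unshelve. all: by end_near. Qed.

Lemma derive1_C1D f g t : C1_pt f t -> C1_pt g t ->
  derive1 (fun s => f s + g s) t = derive1 f t + derive1 g t.
Proof.
move=> hf hg; apply: is_derive1_val.
exact: is_deriveD (C1_pt_is_derive hf) (C1_pt_is_derive hg).
Qed.

Lemma derive1_C1Z (c : R) f t : C1_pt f t ->
  derive1 (fun s => c *: f s) t = c *: derive1 f t.
Proof.
by move=> hf; apply: is_derive1_val; exact: is_deriveZ (C1_pt_is_derive hf).
Qed.

Lemma C1_ptB f g t : C1_pt f t -> C1_pt g t -> C1_pt (fun s => f s - g s) t.
Proof.
move=> hf hg; rewrite (_ : (fun s => _) = fun s => f s + -1 *: g s).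
  by apply: C1_ptD => //; exact: C1_ptZ.
by apply/funext => s; rewrite scaleN1r.
Qed.

Lemma derive1_C1B f g t : C1_pt f t -> C1_pt g t ->
  derive1 (fun s => f s - g s) t = derive1 f t - derive1 g t.
Proof.
move=> hf hg; apply: is_derive1_val.
exact: is_deriveB (C1_pt_is_derive hf) (C1_pt_is_derive hg).
Qed.

Lemma is_derive_ray (v : V) t : is_derive t 1 (fun s : R => s *: v) v.
Proof.
have h : differentiable (fun s : R => s *: v) t by [].
apply: DeriveDef; first exact: diff_derivable.
by rewrite deriveE// diff_val scale1r.
Qed.

Lemma C1_pt_ray (v : V) t : C1_pt (fun s : R => s *: v) t.
Proof.
apply: (@C1_pt_near _ (fun=> v)); last exact: cvg_cst.
by near=> s; exact: is_derive_ray.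
Unshelve. all: by end_near. Qed.

Lemma C1_pt_cst (v : V) t : C1_pt (fun s : R => v) t.
Proof.
apply: (@C1_pt_near _ (fun=> 0)); last exact: cvg_cst.
by near=> s; exact: is_derive_cst.
Unshelve. all: by end_near. Qed.

Lemma C1_on_cont f : C1_on f -> cont_on 0 1 f.
Proof. by move=> hf t /hf/C1_pt_cont. Qed.

Lemma C1_on_cont_derive f : C1_on f -> cont_on 0 1 (derive1 f).
Proof. by move=> hf t /hf[]. Qed.

Lemma C1_on_cont_norm_derive f : C1_on f -> cont_on 0 1 (fun t => `|derive1 f t|).
Proof.
by move=> hf t t01; apply: cvg_norm; exact: C1_on_cont_derive.
Qed.

End Basics.

(** With the maximum norm, it is enough to integrate each coordinate. *)
Lemma C1_increment m n (f : R -> 'M[R]_(m, n)) (s t : R) :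
  C1_on f -> 0 <= s <= 1 -> 0 <= t <= 1 ->
  `|f t - f s| <= mean (fun t => `|derive1 f t|).
Proof.
move=> hf s01 t01; apply: mx_norm_le.
  by apply: mean_ge0 => u _; exact: normr_ge0.
move=> i j; rewrite !mxE.
have hij (u : R) : 0 <= u <= 1 -> is_derive u 1 (fun s => f s i j) (derive1 f u i j).
  by move=> /hf/C1_pt_is_derive; exact: is_derive_coord.
apply: (increment_le_mean s01 t01 hij) => [u u01||u _].
- by apply: cont_coord; exact: C1_on_cont_derive.
- exact: C1_on_cont_norm_derive.
- exact: mx_coord_le.
Qed.

Section Composition.
Variables (n : nat) (W : normedModType R) (U : set 'rV[R]_n) (f : 'rV[R]_n -> W).
Hypotheses (oU : open U) (fC1 : Ck 1 U f).
Implicit Types (p v : 'rV[R]_n) (g : R -> 'rV[R]_n) (t : R).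

(** Reduces directional derivatives to the finitely many partial ones, whose
continuity is what [Ck 1] provides. *)
Lemma derive_partials p v : U p ->
  'D_v f p = \sum_j v 0 j *: 'D_(delta_mx 0 j) f p.
Proof.
move=> Up; have df : differentiable f p by case: fC1 => + _; exact.
rewrite deriveE// {1}(row_sum_delta v) raddf_sum; apply: eq_bigr => j _.
by rewrite deriveE//; exact: (linearZ_LR ('d f p)).
Qed.

Lemma C1_pt_comp_is_derive g t : U (g t) -> derivable g t 1 ->
  is_derive t 1 (f \o g) ('D_(derive1 g t) f (g t)).
Proof.
move=> Ug dg; have df : differentiable f (g t) by case: fC1 => + _; exact.
have dg' : differentiable g t by exact/derivable1_diffP.
have dfg : differentiable (f \o g) t by exact: differentiable_comp.
apply: DeriveDef; first exact: diff_derivable.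
by rewrite deriveE// diff_comp//= derive1E deriveE// deriveE.
Qed.

Lemma cont_derive_along (T : topologicalType) (p v : T -> 'rV[R]_n) (t : T) : U (p t) ->
  {for t, continuous p} -> {for t, continuous v} ->
  {for t, continuous (fun s => 'D_(v s) f (p s))}.
Proof.
move=> Up cp cv.
have nU : \forall s \near t, U (p s).
  by apply: cp; exact: open_nbhs_nbhs.
apply: (@cont_near_eq _ _ _ (fun s => \sum_j v s 0 j *: 'D_(delta_mx 0 j) f (p s))).
  by apply: filterS nU => s /derive_partials.
apply: cvg_sumr => j; apply: cvgZ; first exact: cont_coord.
apply: (continuous_comp cp (g := 'D_(delta_mx 0 j) f)).
by case: fC1 => _ /(_ (delta_mx 0 j)); exact.
Qed.

Lemma C1_pt_comp g t : U (g t) -> C1_pt g t -> C1_pt (f \o g) t.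
Proof.
move=> Ug hg; have cg := C1_pt_cont hg.
apply: (@C1_pt_near _ _ (fun s => 'D_(derive1 g s) f (g s))).
  near=> s; apply: C1_pt_comp_is_derive.
    by near: s; apply: cg; exact: open_nbhs_nbhs.
  by near: s; case: hg.
by apply: cont_derive_along => //; case: hg.
Unshelve. all: by end_near. Qed.

End Composition.

End C1Curves.

(** * Local Lipschitz estimates for smooth matrix fields *)

Section LipschitzEstimates.
Variables (R : realType) (n : nat).
Local Notation V := 'rV[R]_n.
Implicit Types (U : set V) (p q r v : V).

Lemma open_ballP U p0 : open U -> U p0 ->
  \forall rho \near 0^'+, forall p, `|p - p0| < rho :> R -> U p.
Proof.
move=> oU Up0; have /nbhs_normP[e /= e0 he] := open_nbhs_nbhs (conj oU Up0).
near=> rho => p hp; apply: he; rewrite /= distrC (lt_le_trans hp)//.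
by near: rho; exact: nbhs_right_le.
Unshelve. all: by end_near. Qed.

Lemma cont_ballP (W : normedModType R) (f : V -> W) p0 (e : R) :
  {for p0, continuous f} -> 0 < e ->
  \forall rho \near 0^'+, forall p, `|p - p0| < rho :> R -> `|f p - f p0| < e.
Proof.
move=> cf e0; have /cvgrPdist_lt/(_ e e0) := cf.
move=> /nbhs_normP[d /= d0 hd].
near=> rho => p hp; rewrite distrC; apply: hd; rewrite /= distrC (lt_le_trans hp)//.
by near: rho; exact: nbhs_right_le.
Unshelve. all: by end_near. Qed.

Lemma conv_ball p0 (rho : R) p q (t : R) : `|p - p0| < rho -> `|q - p0| < rho ->
  0 <= t <= 1 -> `|q + t *: (p - q) - p0| < rho.
Proof.
move=> hp hq /andP[t0 t1].
have -> : q + t *: (p - q) - p0 = t *: (p - p0) + (1 - t) *: (q - p0).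
  by apply/matrixP => i j; rewrite !mxE; ring.
apply: le_lt_trans (ler_normD _ _) _; rewrite !normrZ (ger0_norm t0).
have t1' : 0 <= 1 - t by rewrite subr_ge0.
rewrite (ger0_norm t1').
have [->|tn0] := eqVneq t 0; first by rewrite mul0r add0r subr0 mul1r.
have tp : 0 < t by rewrite lt_neqAle eq_sym tn0.
have h1 : t * `|p - p0| < t * rho by rewrite ltr_pM2l.
have h2 : (1 - t) * `|q - p0| <= (1 - t) * rho by rewrite ler_wpM2l// ltW.
lra.
Qed.

Section C1Lipschitz.
Variables (m l : nat).

Lemma C1_derive_bound (f : V -> 'M[R]_(m, l)) U p0 : open U -> Ck 1 U f -> U p0 ->
  exists2 C : R, 0 < C & \forall rho \near 0^'+, forall p v,
    `|p - p0| < rho :> R -> `|'D_v f p| <= C * `|v|.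
Proof.
move=> oU fC1 Up0; pose c (j : 'I_n) : R := `|'D_(delta_mx 0 j) f p0| + 1.
have c0 j : 0 <= c j by rewrite addr_ge0.
exists (\sum_j c j + 1); first by rewrite ltr_wpDl// sumr_ge0.
near=> rho => p v hp.
have Up : U p by move: p hp; near: rho; exact: open_ballP.
rewrite (derive_partials fC1)// (le_trans (ler_norm_sum _ _ _))//.
rewrite mulrDl mul1r mulr_suml ler_wpDr//; apply: ler_sum => j _.
rewrite normrZ mulrC ler_pM//; last exact: mx_coord_le.
have : `|'D_(delta_mx 0 j) f p - 'D_(delta_mx 0 j) f p0| < 1.
  move: j p hp {Up}; near: rho; apply: filter_forall => j.
  by apply: (@cont_ballP _ ('D_(delta_mx 0 j) f)) => //; case: fC1 => _ /(_ (delta_mx 0 j)); exact.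
rewrite /c => /ltW h; rewrite -[X in `|X|](subrK ('D_(delta_mx 0 j) f p0)).
by rewrite (le_trans (ler_normD _ _))// addrC lerD2l.
Unshelve. all: by end_near. Qed.

Lemma is_derive_line p v (t : R) : is_derive t 1 (fun s => p + s *: v) v.
Proof.
rewrite -[X in is_derive _ _ _ X]add0r.
by apply: (is_deriveD (f := cst p)); exact: is_derive_ray.
Qed.

Lemma C1_pt_line p v (t : R) : C1_pt (fun s => p + s *: v) t.
Proof. by apply: C1_ptD; [exact: C1_pt_cst|exact: C1_pt_ray]. Qed.

Lemma C1_lipschitz (f : V -> 'M[R]_(m, l)) U p0 : open U -> Ck 1 U f -> U p0 ->
  exists2 L : R, 0 < L & \forall rho \near 0^'+, forall p q,
    `|p - p0| < rho :> R -> `|q - p0| < rho -> `|f p - f q| <= L * `|p - q|.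
Proof.
move=> oU fC1 Up0; have [C C0 hC] := C1_derive_bound oU fC1 Up0.
exists C => //; near=> rho => p q hp hq.
have Uball x : `|x - p0| < rho -> U x.
  by move: x; near: rho; exact: open_ballP.
have hseg t : 0 <= t <= 1 -> `|q + t *: (p - q) - p0| < rho.
  by move=> t01; exact: conv_ball.
pose g t := q + t *: (p - q).
have hg (t : R) : derive1 g t = p - q by apply: is_derive1_val; exact: is_derive_line.
have fg : C1_on (f \o g).
  by move=> t t01; apply: (C1_pt_comp oU fC1); [exact/Uball/hseg|exact: C1_pt_line].
have := C1_increment (s := 0) (t := 1) fg; rewrite !lexx ler01 => /(_ isT isT).
rewrite /g /= scale1r scale0r addr0 (addrC q (p - q)) subrK => /le_trans; apply.
rewrite -[leRHS]mean_cst; apply: mean_le.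
- exact: C1_on_cont_norm_derive.
- by move=> t _; exact: cvg_cst.
- move=> t t01; rewrite (is_derive1_val (C1_pt_comp_is_derive fC1 _ _)); last 2 first.
  + exact/Uball/hseg.
  + exact/C1_pt_derivable/C1_pt_line.
  + rewrite hg; move: (hseg _ t01); rewrite -/(g t); move: (g t) (p - q).
    near: rho; exact: hC.
Unshelve. all: by end_near. Qed.

(** The derivative of [f (r + t x) + f (r - t x)] in [t] is the difference of the
values of ['D_x f] at two points at distance at most [2 |x|], and the
partial derivatives of [f] are Lipschitz. *)
Lemma C2_second_difference (f : V -> 'M[R]_(m, l)) U p0 :
  open U -> Ck 2 U f -> U p0 ->
  exists2 L : R, 0 < L & \forall rho \near 0^'+, forall r x,
    `|r + x - p0| < rho :> R -> `|r - x - p0| < rho ->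
    `|f (r + x) + f (r - x) - 2 *: f r| <= L * `|x| ^+ 2.
Proof.
move=> oU fC2 Up0.
have fC1 : Ck 1 U f.
  case: fC2 => df D; split=> // v x Ux; apply: differentiable_continuous.
  by case: (D v) => + _; exact.
have hj (j : 'I_n) := C1_lipschitz oU (fC2.2 (delta_mx 0 j)) Up0.
pose L j := s2val (cid2 (hj j)).
have L0 j : 0 < L j by exact: (s2valP (cid2 (hj j))).
have hL j := s2valP' (cid2 (hj j)); rewrite -/(L _) in hL.
exists (2 * \sum_j L j + 1).
  by rewrite ltr_wpDl// mulr_ge0// sumr_ge0// => j _; exact: ltW.
near=> rho => r x h1 h2.
have Uball y : `|y - p0| < rho -> U y.
  by move: y; near: rho; exact: open_ballP.
have rx : r + x - (r - x) = 2 *: x by apply/matrixP => i j; rewrite !mxE; ring.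
have r1 (t : R) : r + t *: x = (r - x) + ((1 + t) / 2) *: ((r + x) - (r - x)).
  by rewrite rx; apply/matrixP => i j; rewrite !mxE; field.
have seg (t : R) : -1 <= t <= 1 -> `|r + t *: x - p0| < rho.
  by move=> t11; rewrite r1; apply: conv_ball => //; lra.
have seg1 (t : R) : 0 <= t <= 1 -> `|r + t *: x - p0| < rho.
  by move=> t11; apply: seg; lra.
have seg2 (t : R) : 0 <= t <= 1 -> `|r + t *: (- x) - p0| < rho.
  by move=> t11; rewrite scalerN -scaleNr; apply: seg; lra.
pose g1 (t : R) := r + t *: x; pose g2 (t : R) := r + t *: (- x).
have dg1 (t : R) : derive1 g1 t = x by apply: is_derive1_val; exact: is_derive_line.
have dg2 (t : R) : derive1 g2 t = - x by apply: is_derive1_val; exact: is_derive_line.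
have fg1 : C1_on (f \o g1).
  by move=> t t01; apply: (C1_pt_comp oU fC1); [exact/Uball/seg1|exact: C1_pt_line].
have fg2 : C1_on (f \o g2).
  by move=> t t01; apply: (C1_pt_comp oU fC1); [exact/Uball/seg2|exact: C1_pt_line].
pose h t := (f \o g1) t + (f \o g2) t.
have hC : C1_on h by move=> t t01; apply: C1_ptD; [exact: fg1|exact: fg2].
have := C1_increment (s := 0) (t := 1) hC; rewrite !lexx ler01 => /(_ isT isT).
rewrite /h /g1 /g2 /= !scale1r !scale0r !addr0 -mulr2n -scaler_nat => /le_trans; apply.
rewrite -[leRHS]mean_cst; apply: mean_le.
- exact: C1_on_cont_norm_derive.
- by move=> t _; exact: cvg_cst.
move=> t t01.
have D1 : is_derive t 1 (f \o g1) ('D_x f (g1 t)).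
  rewrite -{1}(dg1 t); apply: (C1_pt_comp_is_derive fC1); first exact/Uball/seg1.
  exact/C1_pt_derivable/C1_pt_line.
have D2 : is_derive t 1 (f \o g2) ('D_(- x) f (g2 t)).
  rewrite -{1}(dg2 t); apply: (C1_pt_comp_is_derive fC1); first exact/Uball/seg2.
  exact/C1_pt_derivable/C1_pt_line.
have D12 := is_deriveD D1 D2; rewrite (is_derive1_val D12).
rewrite (derive_partials fC1 x (Uball _ (seg1 _ t01))).
rewrite (derive_partials fC1 (- x) (Uball _ (seg2 _ t01))) -big_split /=.
rewrite (le_trans (ler_norm_sum _ _ _))//.
rewrite mulrDl ler_wpDr ?mul1r ?sqr_ge0// mulr_sumr mulr_suml.
apply: ler_sum => j _; rewrite mxE scaleNr -scalerBr normrZ.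
have hl : `|'D_(delta_mx 0 j) f (g1 t) - 'D_(delta_mx 0 j) f (g2 t)|
    <= L j * `|g1 t - g2 t|.
  move: (seg1 _ t01) (seg2 _ t01); rewrite -/(g1 t) -/(g2 t).
  move: j (g1 t) (g2 t); near: rho; apply: filter_forall => j; exact: hL.
have g12 : `|g1 t - g2 t| <= 2 * `|x|.
  have -> : g1 t - g2 t = (2 * t) *: x by apply/matrixP => a b; rewrite !mxE; ring.
  rewrite normrZ ler_wpM2r// normrM normr_nat ger0_norm; last by case/andP: t01.
  by case/andP: t01; lra.
rewrite [leRHS](_ : _ = `|x| * (L j * (2 * `|x|))); last by ring.
apply: ler_pM => //; first exact: mx_coord_le.
by rewrite (le_trans hl)// ler_pM2l.
Unshelve. all: by end_near. Qed.

End C1Lipschitz.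

(** By homogeneity it suffices to minimize over the unit sphere, which is compact;
it is empty in dimension zero. *)
Lemma posdef_lower_bound (A : 'M[R]_n) : (forall v : V, v != 0 -> 0 < bil A v v) ->
  exists2 a : R, 0 < a & forall v : V, a * `|v| ^+ 2 <= bil A v v.
Proof.
move=> Apos; pose Sph := [set v : V | `|v| = 1].
have homog (a : R) : (forall v, Sph v -> a <= bil A v v) ->
    forall v : V, a * `|v| ^+ 2 <= bil A v v.
  move=> ha v; have [->|v0] := eqVneq v 0.
    by rewrite normr0 expr0n mulr0 /bil !mul0mx mxE.
  have nv : `|v| != 0 by rewrite normr_eq0.
  have := ha (`|v|^-1 *: v); rewrite /Sph /= normrZ normfV normr_id mulVf//.
  move=> /(_ erefl); rewrite bilZl bilZr mulrA -expr2 exprVn.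
  by rewrite ler_pdivlMl ?exprn_gt0 ?normr_gt0// mulrC.
have [|noSph] := pselect (Sph !=set0); last first.
  exists 1 => //; apply: homog => v Sv; exfalso; apply: noSph; exact: ex_intro Sv.
move=> S0; have cS : compact Sph.
  apply: bounded_closed_compact.
    by exists 1; split; [exact: num_real|move=> x x1 v /= ->; exact: ltW].
  have -> : Sph = (fun v : V => `|v|) @^-1` [set 1] by [].
  apply: closed_comp; last exact: closed_eq.
  by move=> v _; exact: norm_continuous.
have [|c /set_mem cS' hc] := @EVT_min_rV _ _ (fun v : V => bil A v v) Sph S0 cS.
  apply: continuous_subspaceT => v; apply: (@cont_bil _ _ _ (fun=> A) id id).
  - exact: cst_continuous.
  - by move=> B.
  - by move=> B.
exists (bil A c c).
  apply: Apos; apply/eqP => c0; move: cS'; rewrite /Sph /= c0 normr0 => /eqP.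
  by rewrite eq_sym oner_eq0.
by apply: homog => v Sv; apply: hc; exact: mem_set.
Qed.

End LipschitzEstimates.

(** * Uniform bounds on a metric near a point *)

Section LocalMetric.
Variables (R : realType) (n : nat).
Local Notation V := 'rV[R]_n.
Implicit Types (U : set V) (p q r u v x : V) (g : V -> 'M[R]_n).

(** All that the energy estimates use of the metric.  The last bound is a
second-order Taylor estimate: it is what makes the error of averaging two curves
quadratic in their distance. *)
Record metric_bounds g p0 (rho k L : R) : Prop := MetricBounds {
  mb_cont : forall p, `|p - p0| < rho -> {for p, continuous g};
  mb_sym : forall p, `|p - p0| < rho -> (g p)^T = g p;
  mb_lower : forall p v, `|p - p0| < rho -> k ^+ 2 * `|v| ^+ 2 <= bil (g p) v v;
  mb_upper : forall p u v, `|p - p0| < rho -> `|bil (g p) u v| <= L * `|u| * `|v|;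
  mb_lipschitz : forall p q u v, `|p - p0| < rho -> `|q - p0| < rho ->
    `|bil (g p) u v - bil (g q) u v| <= L * `|p - q| * `|u| * `|v|;
  mb_second : forall r x v, `|r + x - p0| < rho -> `|r - x - p0| < rho ->
    `|bil (g (r + x)) v v + bil (g (r - x)) v v - 2 * bil (g r) v v|
      <= L * `|x| ^+ 2 * `|v| ^+ 2 }.

Lemma smooth_metric_bounds U g p0 : open U -> U p0 -> Ck 2 U g ->
  (forall p, U p -> (g p)^T = g p) ->
  (forall p, U p -> forall v, v != 0 -> 0 < bil (g p) v v) ->
  exists k L : R, [/\ 0 < k, 1 <= L &
    \forall rho \near 0^'+, metric_bounds g p0 rho k L].
Proof.
move=> oU Up0 gC2 gs gp.
have gC1 : Ck 1 U g.
  case: gC2 => dg D; split=> // v p Up; apply: differentiable_continuous.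
  by case: (D v) => + _; exact.
have gc p : U p -> {for p, continuous g}.
  by move=> Up; apply: differentiable_continuous; case: gC1 => + _; exact.
have [a a0 ha] := posdef_lower_bound (gp _ Up0).
have [L1 L10 hL1] := C1_lipschitz oU gC1 Up0.
have [L2 L20 hL2] := C2_second_difference oU gC2 Up0.
pose N : R := (n ^ 2)%:R.
have N0 : 0 <= N by exact: ler0n.
pose L := N * (`|g p0| + 1) + N * L1 + N * L2 + 1.
have g00 : 0 <= N * (`|g p0| + 1) by rewrite mulr_ge0// addr_ge0.
have NL1 : 0 <= N * L1 by rewrite mulr_ge0// ltW.
have NL2 : 0 <= N * L2 by rewrite mulr_ge0// ltW.
exists (Num.sqrt (a / 2)), L; split; [by rewrite sqrtr_gt0 divr_gt0|rewrite /L; lra|].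
pose e := a / 2 / (N + 1).
have e0 : 0 < e by rewrite !divr_gt0// ltr_wpDl.
near=> rho.
have Uball y : `|y - p0| < rho -> U y.
  by move: y; near: rho; exact: open_ballP.
split.
- by move=> p /Uball; exact: gc.
- by move=> p /Uball; exact: gs.
- move=> p v hp; rewrite sqr_sqrtr; last by rewrite divr_ge0// ltW.
  have ge : `|g p - g p0| < e.
    by move: p hp; near: rho; apply: cont_ballP => //; exact: gc.
  have := bil_norm (g p - g p0) v v; rewrite bilMB -/N -mulrA -expr2.
  have h1 : N * `|g p - g p0| <= a / 2.
    rewrite -[leRHS](_ : (N + 1) * e = _); last first.
      by rewrite /e mulrC divfK// lt0r_neq0// ltr_wpDl.
    by apply: ler_pM => //; [lra|exact: ltW].
  have h2 : N * `|g p - g p0| * `|v| ^+ 2 <= a / 2 * `|v| ^+ 2.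
    by rewrite ler_wpM2r// sqr_ge0.
  have := ha v; rewrite ler_norml => h3 /andP[h4 _]; lra.
- move=> p u v hp; apply: (le_trans (bil_norm _ _ _)).
  rewrite !ler_wpM2r// -/N.
  have ge : `|g p - g p0| < 1.
    by move: p hp; near: rho; apply: cont_ballP => //; exact: gc.
  have h : `|g p| <= `|g p0| + 1.
    by rewrite -[g p](subrK (g p0)) (le_trans (ler_normD _ _))// addrC lerD2l ltW.
  have := ler_wpM2l N0 h; rewrite /L; lra.
- move=> p q u v hp hq; rewrite -bilMB (le_trans (bil_norm _ _ _))//.
  rewrite !ler_wpM2r// -/N.
  have h : `|g p - g q| <= L1 * `|p - q|.
    by move: p q hp hq; near: rho; exact: hL1.
  rewrite (le_trans (ler_wpM2l N0 h))// mulrA ler_wpM2r// /L; lra.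
- move=> r x v h1 h2; rewrite -bilMD -bilMZ -bilMB (le_trans (bil_norm _ _ _))//.
  rewrite -mulrA -expr2 ler_wpM2r ?sqr_ge0// -/N.
  have h : `|g (r + x) + g (r - x) - 2 *: g r| <= L2 * `|x| ^+ 2.
    by move: r x h1 h2; near: rho; exact: hL2.
  rewrite (le_trans (ler_wpM2l N0 h))// mulrA ler_wpM2r ?sqr_ge0// /L; lra.
Unshelve. all: by end_near. Qed.

End LocalMetric.

(** * Energy estimates in coordinates *)

Lemma shift_cost_le (R : realFieldType) (L M N delta w : R) :
  0 <= L -> 0 <= M -> 0 <= N -> 0 <= w -> 0 <= delta -> delta <= 1 ->
  N * w <= 4 * N * delta ->
  L * (N * w) * (2 * M * delta + N * w) ^+ 2 + 2 * L * (N * w) * (2 * M * delta)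
    + L * (N * w) ^+ 2
  <= L * N * ((2 * M + 4 * N) ^+ 2 + 4 * M + 4 * N) * delta * w.
Proof.
move=> L0 M0 N0 w0 d0 d1 Nw; set eps := N * w in Nw *.
have eps0 : 0 <= eps by rewrite mulr_ge0.
have Md0 : 0 <= 2 * M * delta by rewrite !mulr_ge0.
rewrite [leRHS](_ : _ =
    L * eps * ((2 * M + 4 * N) ^+ 2 * delta + 4 * M * delta + 4 * N * delta)); last first.
  by rewrite /eps; ring.
rewrite [leLHS](_ : _ =
    L * eps * ((2 * M * delta + eps) ^+ 2 + 4 * M * delta + eps)); last by ring.
have h : 2 * M * delta + eps <= (2 * M + 4 * N) * delta by lra.
rewrite ler_wpM2l ?mulr_ge0// !lerD//.
apply: (@le_trans _ _ (((2 * M + 4 * N) * delta) ^+ 2)).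
  by rewrite lerXn2r ?nnegrE ?addr_ge0// (le_trans _ h)// addr_ge0.
by rewrite exprMn ler_wpM2l ?sqr_ge0// expr2 ler_piMl.
Qed.

Lemma average_arith (R : realFieldType) (A P k2 D2 Q v2 X Y : R) :
  X + Y <= k2 / 2 * D2 -> k2 * D2 <= k2 * Q -> k2 * v2 <= k2 * (4 * D2) ->
  (A + P + X) * 1 + Y + - k2 * Q <= A + P - k2 / 8 * v2.
Proof. by move=> h1 h2 h3; lra. Qed.

Lemma pointwise_arith (R : realFieldType) (E G A P C X1 X2 Y1 Y2 k2 w : R) :
  E <= G + C -> G <= A + (X1 + X2 - k2 * w) -> C <= P -> X1 <= Y1 -> X2 <= Y2 ->
  E <= (A + P + Y1) * 1 + Y2 + - k2 * w.
Proof. by move=> h1 h2 h3 h4 h5; lra. Qed.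

Section EnergyEstimates.
Variables (R : realType) (n : nat).
Local Notation V := 'rV[R]_n.
Variables (g : V -> 'M[R]_n) (p0 : V) (rho k L : R).
Hypotheses (k0 : 0 < k) (L1 : 1 <= L) (mb : metric_bounds g p0 rho k L).
Implicit Types (p q r u v w x y z e : V) (a b c : R -> V).

Definition in_ball (rad : R) p := `|p - p0| < rad.

Definition energy_density c (t : R) := bil (g (c t)) (derive1 c t) (derive1 c t).

Let L0 : 0 <= L. Proof. exact: le_trans ler01 L1. Qed.

Lemma energy_density_cont c : C1_on c ->
  (forall t, 0 <= t <= 1 -> in_ball rho (c t)) -> cont_on 0 1 (energy_density c).
Proof.
move=> hc cB t t01; apply: cont_bil; [|exact: C1_on_cont_derive..].
apply: (continuous_comp (f := c) (g := g)); first exact: C1_on_cont.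
by apply: (mb_cont mb); exact: cB.
Qed.

(** The cost of moving the base point and the velocity by at most [eps] is small
against [eps] when the speed is small, up to terms of higher order in [eps]. *)
Lemma energy_perturb r r' (s : V) w (eps : R) : in_ball rho r -> in_ball rho r' ->
  `|r' - r| <= eps -> `|w| <= eps ->
  bil (g r') (s + w) (s + w) <= bil (g r) s s
    + (L * eps * (`|s| + eps) ^+ 2 + 2 * L * eps * `|s| + L * eps ^+ 2).
Proof.
move=> hr hr' hrr hw.
have e0 : 0 <= eps by exact: le_trans hw.
have sw : `|s + w| <= `|s| + eps by rewrite (le_trans (ler_normD _ _))// lerD2l.
have h1 : `|bil (g r') (s + w) (s + w) - bil (g r) (s + w) (s + w)|
    <= L * eps * (`|s| + eps) ^+ 2.
  rewrite (le_trans (mb_lipschitz mb _ _ hr' hr))// -mulrA -expr2.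
  apply: ler_pM => //; rewrite ?mulr_ge0//.
    by rewrite ler_wpM2l.
  by rewrite lerXn2r ?nnegrE ?addr_ge0.
have h2 : `|bil (g r) s w| <= L * eps * `|s|.
  rewrite (le_trans (mb_upper mb _ _ hr))// mulrAC ler_wpM2r// ler_wpM2l//.
have h3 : `|bil (g r) w w| <= L * eps ^+ 2.
  rewrite (le_trans (mb_upper mb _ _ hr))// -mulrA -expr2 ler_wpM2l//.
  by rewrite lerXn2r ?nnegrE.
have sym : bil (g r) w s = bil (g r) s w by apply: bilC; exact: (mb_sym mb).
have ex : bil (g r) (s + w) (s + w) = bil (g r) s s + 2 * bil (g r) s w + bil (g r) w w.
  by rewrite bilDl !bilDr sym; ring.
move: h1; rewrite ex !ler_norml.
move: h2 h3; rewrite !ler_norml => /andP[_ h2] /andP[_ h3] /andP[_ h1].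
by lra.
Qed.

(** The parallelogram identity for the quadratic form [g r] yields the gain
[- k ^+ 2 * `|w| ^+ 2]; the two other terms come from the variation of [g]
between [r - x] and [r + x].  They are small against the gain once [`|x|] is
controlled by [`|w|] and the velocity [s] is small. *)
Lemma energy_midpoint_convex r x (s : V) w : in_ball rho r ->
  in_ball rho (r + x) -> in_ball rho (r - x) ->
  bil (g r) s s <=
    (bil (g (r + x)) (s + w) (s + w) + bil (g (r - x)) (s - w) (s - w)) / 2
    + (L / 2 * `|x| ^+ 2 * `|s| ^+ 2 + 2 * L * `|x| * `|s| * `|w|
       - k ^+ 2 * `|w| ^+ 2).
Proof.
move=> hr h1 h2.
have := mb_second mb s h1 h2; have := mb_lipschitz mb s w h1 h2.
have -> : r + x - (r - x) = 2 *: x by apply/matrixP => i j; rewrite !mxE; ring.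
rewrite normrZ normr_nat !ler_norml => /andP[a1 _] /andP[a2 _].
have a3 := mb_lower mb w h1; have a4 := mb_lower mb w h2.
rewrite !bilDl !bilDr !bilNl !bilNr.
rewrite (bilC w s (mb_sym mb h1)) (bilC w s (mb_sym mb h2)); lra.
Qed.

Section Distance.
Variable d : V -> V -> R.
Hypothesis d_ge0 : forall p q, 0 <= d p q.
Hypothesis d_energy : forall c, C1_on c ->
  (forall t, 0 <= t <= 1 -> in_ball rho (c t)) ->
  d (c 0) (c 1) ^+ 2 <= mean (energy_density c).

(** A minimizing geodesic, as the estimates see it: the energy density is constant,
equal to the square of the distance of the endpoints. *)
Definition minimizer (rad : R) p q c :=
  [/\ C1_on c, c 0 = p, c 1 = q, forall t, 0 <= t <= 1 -> in_ball rad (c t) &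
    forall t, 0 <= t <= 1 -> energy_density c t = d p q ^+ 2].

Lemma in_ball_seg rad p q (t : R) : in_ball rad p -> in_ball rad q ->
  0 <= t <= 1 -> in_ball rad (p + t *: (q - p)).
Proof. by move=> hp hq; exact: conv_ball. Qed.

Let line_C1 p v : C1_on (fun t => p + t *: v).
Proof. by move=> t _; exact: C1_pt_line. Qed.

Let derive_line p v (t : R) : derive1 (fun t => p + t *: v) t = v.
Proof. by apply: is_derive1_val; exact: is_derive_line. Qed.

Lemma dist_le p q : in_ball rho p -> in_ball rho q ->
  d p q <= L * `|q - p|.
Proof.
move=> hp hq; pose c t := p + t *: (q - p).
have cB t : 0 <= t <= 1 -> in_ball rho (c t) by move=> ?; exact: in_ball_seg.
have cC : C1_on c by exact: line_C1.
have := d_energy cC cB; rewrite /c scale0r addr0 scale1r addrC subrK => h.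
have h2 : mean (energy_density c) <= L * `|q - p| ^+ 2.
  rewrite -[leRHS]mean_cst; apply: mean_le; first exact: energy_density_cont.
    by move=> t _; exact: cst_continuous.
  move=> t t01; rewrite /energy_density derive_line expr2 mulrA.
  exact: le_trans (ler_norm _) (mb_upper mb _ _ (cB t t01)).
have : d p q ^+ 2 <= (L * `|q - p|) ^+ 2.
  rewrite (le_trans h)// (le_trans h2)// exprMn ler_wpM2r ?sqr_ge0//.
  by rewrite expr2 ler_peMr.
by rewrite ler_pXn2r ?nnegrE ?mulr_ge0.
Qed.

Lemma minimizer_speed rad p q c (t : R) : rad <= rho -> in_ball rad p ->
  in_ball rad q -> minimizer rad p q c -> 0 <= t <= 1 ->
  `|derive1 c t| <= L / k * `|q - p|.
Proof.
move=> rr hp hq [cC c0 c1 cB cE] t01.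
have := mb_lower mb (derive1 c t) (lt_le_trans (cB t t01) rr).
rewrite -/(energy_density c t) cE// -exprMn ler_pXn2r ?nnegrE ?mulr_ge0 ?(ltW k0)//.
move=> h; rewrite mulrAC ler_pdivlMr// mulrC (le_trans h)//.
by apply: dist_le; exact: lt_le_trans rr.
Qed.

Lemma minimizer_stay rad p q c (t : R) : rad <= rho -> in_ball rad p ->
  in_ball rad q -> minimizer rad p q c -> 0 <= t <= 1 ->
  `|c t - p| <= L / k * `|q - p|.
Proof.
move=> rr hp hq cm t01; have [cC c0 _ _ _] := cm.
have /= := C1_increment (s := 0) cC _ t01; rewrite lexx ler01 c0 => /(_ isT).
move=> /le_trans; apply; rewrite -[leRHS]mean_cst; apply: mean_le.
- exact: C1_on_cont_norm_derive.
- exact: cont_on_cst.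
- by move=> s s01; exact: (minimizer_speed rr hp hq cm).
Qed.

(** Let [l] be the segment from [p] to [q], [v = q - p] its velocity and
[xi = c - l].  As [c] has no more energy than [l], expanding the energy of [c]
around the velocity [v] bounds the mean of [k ^+ 2 * `|xi'| ^+ 2] by two kinds
of terms: the variation of [g] between [c] and [l], and the cross term
[bil (g c) v xi'].  Freezing [g] at [p] in the cross term costs one more factor
[`|v|], and what is left integrates to zero because [xi] vanishes at both ends.
Hence [`|xi|] is of order [`|v| ^+ 2]. *)
Lemma minimizer_near_segment rad p q c (t : R) : rad <= rho -> in_ball rad p ->
  in_ball rad q -> minimizer rad p q c -> 0 <= t <= 1 ->
  `|c t - (p + t *: (q - p))| <=
    L * (1 + 2 * (L / k)) / k ^+ 2 * `|q - p| ^+ 2.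
Proof.
move=> rr hp hq cm; have [cC c0 c1 cB cE] := cm.
have brho x : in_ball rad x -> in_ball rho x by move=> hx; exact: lt_le_trans rr.
set M := L / k; have [v vE] : exists v, v = q - p by exists (q - p).
pose l t := p + t *: v; rewrite -vE.
have M0 : 0 <= M by rewrite divr_ge0// ltW.
pose xi t := c t - l t.
have [D DE] : exists D, D = mean (fun t => `|derive1 xi t|) by eexists.
have lC : C1_on l by exact: line_C1.
have lB t' : 0 <= t' <= 1 -> in_ball rho (l t').
  by move=> ?; rewrite /l vE; apply: in_ball_seg => //; exact: brho.
have xC : C1_on xi by move=> s s01; apply: C1_ptB; [exact: cC|exact: lC].
have dxi s : 0 <= s <= 1 -> derive1 c s = v + derive1 xi s.
  by move=> s01; rewrite (derive1_C1B (cC s s01) (lC s s01)) derive_line addrC subrK.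
have l0 : l 0 = p by rewrite /l scale0r addr0.
have l1 : l 1 = q by rewrite /l scale1r vE addrC subrK.
have xi0 : xi 0 = 0 by rewrite /xi c0 l0 subrr.
have xi1 : xi 1 = 0 by rewrite /xi c1 l1 subrr.
have xiD s : 0 <= s <= 1 -> `|xi s| <= D.
  move=> s01; have := C1_increment (s := 0) xC _ s01.
  by rewrite lexx ler01 xi0 subr0 DE; exact.
have D0 : 0 <= D by rewrite DE; exact: mean_ge0.
have [Q QE] : exists Q, Q = mean (fun t => `|derive1 xi t| ^+ 2) by eexists.
have DQ : D ^+ 2 <= Q.
  by rewrite DE QE; apply: mean_sqr_ge; exact: C1_on_cont_norm_derive.
pose h (t : R) := bil (g p) v (derive1 xi t).
have hC : cont_on 0 1 h.
  move=> s s01; apply: (@cont_bil _ _ _ (fun=> g p) (fun=> v) (derive1 xi)).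
  - exact: cst_continuous.
  - exact: cst_continuous.
  - exact: C1_on_cont_derive.
(* The frozen cross term is the derivative of [bil (g p) v xi]. *)
have h0 : mean h = 0.
  have dh (s : R) : 0 <= s <= 1 -> is_derive s 1 (fun s => bil (g p) v (xi s)) (h s).
    move=> s01; apply: is_derive_eq.
      exact: (is_derive_bil (is_derive_cst (g p) s 1) (is_derive_cst v s 1)
        (C1_pt_is_derive (xC s s01))).
    by rewrite /bil mulmx0 !mul0mx mxE !add0r.
  by rewrite (mean_derive dh hC) xi0 xi1 subrr.
have hE (u : R) : h u = bil (g p) v (derive1 xi u) by [].
clearbody h.
have lmin := d_energy lC lB; rewrite l0 l1 in lmin.
have point s : 0 <= s <= 1 ->
    1 * energy_density l s + 2 * h s + k ^+ 2 * `|derive1 xi s| ^+ 2 <=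
    (d p q ^+ 2 + L * D * `|v| ^+ 2) * 1 +
    (2 * L * M * `|v| ^+ 2) * `|derive1 xi s| + 0 * 1.
  move=> s01; rewrite -(cE s s01) /energy_density dxi// derive_line.
  have hc := brho _ (cB s s01).
  have a1 : `|bil (g (c s)) v v - bil (g (l s)) v v| <= L * D * `|v| ^+ 2.
    rewrite (le_trans (mb_lipschitz mb _ _ hc (lB s s01)))// -mulrA -expr2.
    by rewrite ler_wpM2r ?sqr_ge0// ler_wpM2l//; exact: xiD.
  have a2 : `|bil (g (c s)) v (derive1 xi s) - h s| <=
      L * M * `|v| ^+ 2 * `|derive1 xi s|.
    have := minimizer_stay rr hp hq cm s01; rewrite -/M -vE hE => hs.
    rewrite (le_trans (mb_lipschitz mb _ _ hc (brho _ hp)))//.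
    rewrite [leRHS](_ : _ = L * (M * `|v|) * `|v| * `|derive1 xi s|); last by ring.
    by rewrite ler_wpM2r// ler_wpM2r// ler_wpM2l.
  have a3 := mb_lower mb (derive1 xi s) hc.
  rewrite !bilDl !bilDr (bilC (derive1 xi s) v (mb_sym mb hc)).
  move: a1 a2; rewrite !ler_norml => /andP[a1 _] /andP[a2 _].
  clear -a1 a2 a3; clearbody M xi l; lra.
have cn := C1_on_cont_norm_derive xC.
have cl : cont_on 0 1 (energy_density l) by exact: energy_density_cont.
have cu : @cont_on R R 0 1 (fun=> 1) by exact: cont_on_cst.
have := mean_le (cont_on_lin3 cl hC (cont_on_sqr cn)) (cont_on_lin3 cu cn cu) point.
rewrite !mean_lin3//; last exact: cont_on_sqr.
rewrite h0 -DE -QE mean_cst => hm t01.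
apply: (le_trans (xiD t t01)); rewrite mulrAC ler_pdivlMr ?exprn_gt0//.
have [->|Dn0] := eqVneq D 0.
  by rewrite mul0r mulr_ge0 ?sqr_ge0// mulr_ge0// addr_ge0// mulr_ge0.
have Dp : 0 < D by rewrite lt_neqAle eq_sym Dn0.
rewrite -(ler_pM2r Dp).
have : k ^+ 2 * D ^+ 2 <= k ^+ 2 * Q by rewrite ler_wpM2l// sqr_ge0.
move: lmin hm; move: (mean (energy_density l)) => m; clearbody M; lra.
Qed.

Hypothesis rho0 : 0 < rho.

Let half_rho : rho / 2 <= rho.
Proof. by rewrite ler_pdivrMr// ler_peMr ?ler1n// ltW. Qed.

(** The test curve is [c] plus an affine correction of its endpoints. *)
Lemma minimizer_perturb p q c e0 e1 (eps Sp : R) : minimizer (rho / 2) p q c ->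
  (forall t, 0 <= t <= 1 -> `|derive1 c t| <= Sp) ->
  `|e0| <= eps -> `|e1| <= eps -> 2 * eps <= rho / 2 ->
  d (p + e0) (q + e1) ^+ 2 <= d p q ^+ 2 +
    (L * (2 * eps) * (Sp + 2 * eps) ^+ 2 + 2 * L * (2 * eps) * Sp
     + L * (2 * eps) ^+ 2).
Proof.
move=> [cC c0 c1 cB cE] cS he0 he1 erho.
have eps0 : 0 <= eps by exact: le_trans he0.
have Sp0 : 0 <= Sp by apply: le_trans (cS 0 _); rewrite // lexx ler01.
have brho x : in_ball (rho / 2) x -> in_ball rho x.
  by move=> hx; exact: lt_le_trans half_rho.
pose b t := e0 + t *: (e1 - e0); pose s t := c t + b t.
have bC : C1_on b by exact: line_C1.
have b_le t : 0 <= t <= 1 -> `|b t| <= 2 * eps.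
  move=> /andP[t0 t1]; rewrite /b.
  have -> : e0 + t *: (e1 - e0) = (1 - t) *: e0 + t *: e1.
    by apply/matrixP => i j; rewrite !mxE; ring.
  rewrite (le_trans (ler_normD _ _))// !normrZ (ger0_norm t0) ger0_norm ?subr_ge0//.
  have : (1 - t) * `|e0| <= 1 * eps by apply: ler_pM; rewrite // ?subr_ge0//; lra.
  have : t * `|e1| <= 1 * eps by apply: ler_pM.
  lra.
have e10 : `|e1 - e0| <= 2 * eps by rewrite (le_trans (ler_normB _ _))//; lra.
have sB t : 0 <= t <= 1 -> in_ball rho (s t).
  move=> t01; rewrite /in_ball /s addrAC (le_lt_trans (ler_normD _ _))//.
  by have := cB t t01; have := b_le t t01; rewrite /in_ball; lra.
have sC : C1_on s by move=> t t01; apply: C1_ptD; [exact: cC|exact: bC].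
have := d_energy sC sB; rewrite /s c0 c1 /b scale0r addr0 scale1r (addrC e0 (e1 - e0)) subrK.
move=> /le_trans; apply; rewrite -[leRHS]mean_cst; apply: mean_le.
- exact: energy_density_cont.
- exact: cont_on_cst.
move=> t t01; rewrite /energy_density (derive1_C1D (cC t t01) (bC t t01)).
rewrite derive_line -(cE t t01).
apply: le_trans (energy_perturb _ (brho _ (cB t t01)) (sB t t01) _ e10) _.
  by rewrite /s addrAC subrr add0r; exact: b_le.
rewrite lerD2l lerD2r lerD//.
  rewrite ler_wpM2l ?mulr_ge0// lerXn2r ?nnegrE ?addr_ge0 ?mulr_ge0// lerD2r.
  exact: cS.
by rewrite ler_wpM2l ?mulr_ge0//; exact: cS.
Qed.

(** The test curve is [r], the average of [a] and [b], plus an affine correction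
that moves its starting point by [e] and fixes its end.  Half the difference [x]
of [a] and [b] vanishes at time one, so that it is bounded by the mean [D] of
[`|x'|]; hence the errors of [energy_midpoint_convex] are at most a small multiple
of [D ^+ 2], which is at most the mean of [`|x'| ^+ 2], while the gain is
[k ^+ 2] times that mean.  Finally [D] is at least half the distance of [a 0] and
[b 0]. *)
Lemma averaged_curve_energy a b e (EA EB S eps : R) :
  C1_on a -> C1_on b ->
  (forall t, 0 <= t <= 1 -> in_ball (rho / 2) (a t)) ->
  (forall t, 0 <= t <= 1 -> in_ball (rho / 2) (b t)) ->
  (forall t, 0 <= t <= 1 -> energy_density a t = EA) ->
  (forall t, 0 <= t <= 1 -> energy_density b t = EB) ->
  (forall t, 0 <= t <= 1 -> `|derive1 a t| <= S) ->
  (forall t, 0 <= t <= 1 -> `|derive1 b t| <= S) ->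
  a 1 = b 1 -> `|e| <= eps -> eps <= rho / 2 ->
  L / 2 * S ^+ 2 + 2 * L * S <= k ^+ 2 / 2 ->
  d (2^-1 *: (a 0 + b 0) + e) (a 1) ^+ 2 <=
    (EA + EB) / 2 + (L * eps * (S + eps) ^+ 2 + 2 * L * eps * S + L * eps ^+ 2)
    - k ^+ 2 / 8 * `|b 0 - a 0| ^+ 2.
Proof.
move=> aC bC aB bB aE bE aS bS ab1 he epsrho hS.
have eps0 : 0 <= eps by exact: le_trans he.
have S0 : 0 <= S by apply: le_trans (aS 0 _); rewrite // lexx ler01.
have brho p : in_ball (rho / 2) p -> in_ball rho p.
  by move=> hp; exact: lt_le_trans half_rho.
have half01 : 0 <= (2^-1 : R) <= 1 by rewrite invr_ge0 invf_le1 ?ler1n ?ler0n.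
pose r t := 2^-1 *: (a t + b t); pose x t := 2^-1 *: (a t - b t).
have rxa t : r t + x t = a t by apply/matrixP => i j; rewrite !mxE; field.
have rxb t : r t - x t = b t by apply/matrixP => i j; rewrite !mxE; field.
have rC : C1_on r by move=> t t01; exact: C1_ptZ (C1_ptD (aC t t01) (bC t t01)).
have xC : C1_on x by move=> t t01; exact: C1_ptZ (C1_ptB (aC t t01) (bC t t01)).
have dr t : 0 <= t <= 1 -> derive1 r t = 2^-1 *: (derive1 a t + derive1 b t).
  move=> t01; rewrite (derive1_C1Z _ (C1_ptD (aC t t01) (bC t t01))).
  by rewrite (derive1_C1D (aC t t01) (bC t t01)).
have dx t : 0 <= t <= 1 -> derive1 x t = 2^-1 *: (derive1 a t - derive1 b t).
  move=> t01; rewrite (derive1_C1Z _ (C1_ptB (aC t t01) (bC t t01))).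
  by rewrite (derive1_C1B (aC t t01) (bC t t01)).
have r_speed t : 0 <= t <= 1 -> `|derive1 r t| <= S.
  move=> t01; rewrite (dr t t01) normrZ ger0_norm; last by case/andP: half01.
  rewrite mulrC ler_pdivrMr ?ltr0n// mulr_natr mulr2n.
  exact: le_trans (ler_normD _ _) (lerD (aS t t01) (bS t t01)).
have rB t : 0 <= t <= 1 -> in_ball (rho / 2) (r t).
  move=> t01; have -> : r t = b t + 2^-1 *: (a t - b t).
    by apply/matrixP => i j; rewrite !mxE; field.
  exact: (in_ball_seg (bB t t01) (aB t t01) half01).
have [D DE] : exists D, D = mean (fun t => `|derive1 x t|) by eexists.
have [Q QE] : exists Q, Q = mean (fun t => `|derive1 x t| ^+ 2) by eexists.
have cn := C1_on_cont_norm_derive xC.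
have DQ : D ^+ 2 <= Q by rewrite DE QE; exact: mean_sqr_ge.
have D0 : 0 <= D by rewrite DE; exact: mean_ge0.
have xD t : 0 <= t <= 1 -> `|x t| <= D.
  move=> t01; have := C1_increment (s := 1) xC _ t01.
  by rewrite lexx ler01 {2}/x ab1 subrr scaler0 subr0 DE; exact.
have vD : `|b 0 - a 0| <= D * 2.
  have := xD 0; rewrite lexx ler01 /x normrZ distrC ger0_norm; last by case/andP: half01.
  by rewrite mulrC ler_pdivrMr ?ltr0n//; exact.
pose s t := r t + (e + t *: (- e)).
have lC : C1_on (fun t => e + t *: (- e)) by exact: line_C1.
have sC : C1_on s by move=> t t01; exact: C1_ptD (rC t t01) (lC t t01).
have shift t : 0 <= t <= 1 -> `|s t - r t| <= eps.
  move=> /andP[t0 t1]; rewrite /s addrAC subrr add0r.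
  have -> : e + t *: (- e) = (1 - t) *: e by apply/matrixP => i j; rewrite !mxE; ring.
  rewrite normrZ ger0_norm ?subr_ge0// (le_trans _ he)// ler_piMl//.
  by rewrite lerBlDr lerDl.
have sB t : 0 <= t <= 1 -> in_ball rho (s t).
  move=> t01; rewrite /in_ball -(subrK (r t) (s t)) -addrA [rho]splitr.
  apply: (le_lt_trans (ler_normD _ _)); apply: ler_ltD; last exact: rB.
  exact: le_trans (shift t t01) epsrho.
have s0 : s 0 = 2^-1 *: (a 0 + b 0) + e by rewrite /s /r scale0r addr0.
have s1 : s 1 = a 1.
  by rewrite /s /r -ab1; apply/matrixP => i j; rewrite !mxE; field.
have [P PE] : exists P, P =
  L * eps * (S + eps) ^+ 2 + 2 * L * eps * S + L * eps ^+ 2 by eexists.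
have [A AE] : exists A, A = (EA + EB) / 2 by eexists.
rewrite -s0 -s1 -PE -AE.
have point t : 0 <= t <= 1 -> energy_density s t <=
    (A + P + L / 2 * D ^+ 2 * S ^+ 2) * 1
    + (2 * L * D * S) * `|derive1 x t| + (- k ^+ 2) * `|derive1 x t| ^+ 2.
  move=> t01; rewrite /energy_density (derive1_C1D (rC t t01) (lC t t01)) derive_line.
  have hr := brho _ (rB t t01).
  have heN : `|- e| <= eps by rewrite normrN.
  have h3 := energy_perturb (derive1 r t) hr (sB t t01) (shift t t01) heN.
  have ha : in_ball rho (r t + x t) by rewrite rxa; exact/brho/aB.
  have hb : in_ball rho (r t - x t) by rewrite rxb; exact/brho/bB.
  have h4 := energy_midpoint_convex (derive1 r t) (derive1 x t) hr ha hb.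
  have da : derive1 r t + derive1 x t = derive1 a t.
    by rewrite (dr t t01) (dx t t01); apply/matrixP => i j; rewrite !mxE; field.
  have db : derive1 r t - derive1 x t = derive1 b t.
    by rewrite (dr t t01) (dx t t01); apply/matrixP => i j; rewrite !mxE; field.
  move: h4; rewrite da db rxa rxb -/(energy_density a t) -/(energy_density b t).
  rewrite (aE t t01) (bE t t01) -AE => h4.
  have rs := r_speed t t01; have xd := xD t t01.
  have hP : L * eps * (`|derive1 r t| + eps) ^+ 2 + 2 * L * eps * `|derive1 r t|
      + L * eps ^+ 2 <= P.
    rewrite PE lerD2r lerD//; last by rewrite ler_wpM2l ?mulr_ge0.
    by rewrite ler_wpM2l ?mulr_ge0// lerXn2r ?nnegrE ?addr_ge0// lerD2r.
  have hx1 : L / 2 * `|x t| ^+ 2 * `|derive1 r t| ^+ 2 <= L / 2 * D ^+ 2 * S ^+ 2.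
    apply: ler_pM; rewrite ?mulr_ge0 ?sqr_ge0 ?invr_ge0//.
      by rewrite ler_wpM2l ?mulr_ge0 ?invr_ge0// lerXn2r ?nnegrE.
    by rewrite lerXn2r ?nnegrE.
  have hx2 : 2 * L * `|x t| * `|derive1 r t| * `|derive1 x t| <=
      2 * L * D * S * `|derive1 x t|.
    rewrite ler_wpM2r//; apply: ler_pM; rewrite ?mulr_ge0//.
    by rewrite ler_wpM2l ?mulr_ge0.
  exact: pointwise_arith h3 h4 hP hx1 hx2.
have cu : @cont_on R R 0 1 (fun=> 1) by exact: cont_on_cst.
have := d_energy sC sB => /le_trans; apply.
apply: (le_trans (mean_le (energy_density_cont sC sB)
  (cont_on_lin3 cu cn (cont_on_sqr cn)) point)).
rewrite (mean_lin3 _ _ _ cu cn (cont_on_sqr cn)) mean_cst -DE -QE.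
have hC2 : L / 2 * D ^+ 2 * S ^+ 2 + 2 * L * D * S * D <= k ^+ 2 / 2 * D ^+ 2.
  rewrite [leLHS](_ : _ = (L / 2 * S ^+ 2 + 2 * L * S) * D ^+ 2); last by ring.
  by rewrite ler_wpM2r ?sqr_ge0.
have hQ : k ^+ 2 * D ^+ 2 <= k ^+ 2 * Q by rewrite ler_wpM2l// sqr_ge0.
have hv : k ^+ 2 * `|b 0 - a 0| ^+ 2 <= k ^+ 2 * (4 * D ^+ 2).
  rewrite [4 * _](_ : _ = (D * 2) ^+ 2); last by ring.
  by rewrite ler_wpM2l ?sqr_ge0// lerXn2r ?nnegrE ?mulr_ge0.
exact: average_arith hC2 hQ hv.
Qed.

Definition perturb_const := 2 * L * (L / k * rho + rho) ^+ 2 + 4 * L * (L / k * rho) + 2 * L * rho.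

Lemma perturb_const_ge0 : 0 <= perturb_const.
Proof.
have r0 := ltW rho0.
have s0 : 0 <= L / k * rho := mulr_ge0 (divr_ge0 L0 (ltW k0)) r0.
have L2 : 0 <= 2 * L := mulr_ge0 (ler0n _ 2) L0.
have L4 : 0 <= 4 * L := mulr_ge0 (ler0n _ 4) L0.
exact: addr_ge0 (addr_ge0 (mulr_ge0 L2 (sqr_ge0 _)) (mulr_ge0 L4 s0)) (mulr_ge0 L2 r0).
Qed.

Lemma perturb_cost_le (Sp eps : R) : 0 <= Sp -> 0 <= eps -> 2 * eps <= rho ->
  L * (2 * eps) * (Sp + 2 * eps) ^+ 2 + 2 * L * (2 * eps) * Sp + L * (2 * eps) ^+ 2
  <= (2 * L * (Sp + rho) ^+ 2 + 4 * L * Sp + 2 * L * rho) * eps.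
Proof.
move=> Sp0 eps0 er.
have r0 := ltW rho0.
rewrite [leRHS](_ : _ = L * (2 * eps) * (Sp + rho) ^+ 2 + 2 * L * (2 * eps) * Sp
  + L * (2 * eps * rho)); last by ring.
rewrite lerD//; last by rewrite ler_wpM2l// expr2 ler_wpM2l// mulr_ge0.
rewrite lerD2r ler_wpM2l ?mulr_ge0// lerXn2r ?nnegrE ?addr_ge0 ?mulr_ge0//.
by rewrite lerD2l.
Qed.

Lemma dist_sqr_perturb (eta eps : R) p q p' q' c : eta <= rho / 8 ->
  in_ball eta p -> in_ball eta q -> minimizer (rho / 2) p q c ->
  `|p' - p| <= eps -> `|q' - q| <= eps -> eps <= 2 * eta ->
  d p' q' ^+ 2 <= d p q ^+ 2 + perturb_const * eps.
Proof.
move=> eta_rho hp hq hc ep eq e_eta.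
have r0 := ltW rho0.
have eps0 : 0 <= eps by exact: le_trans ep.
have eta2 : eta <= rho / 2 by lra.
have hp2 : in_ball (rho / 2) p by exact: lt_le_trans eta2.
have hq2 : in_ball (rho / 2) q by exact: lt_le_trans eta2.
have speed t : 0 <= t <= 1 -> `|derive1 c t| <= L / k * rho.
  move=> t01; rewrite (le_trans (minimizer_speed half_rho hp2 hq2 hc t01))//.
  rewrite ler_wpM2l ?divr_ge0 ?(ltW k0)//.
  have -> : q - p = (q - p0) - (p - p0) by apply/matrixP => a b; rewrite !mxE; ring.
  rewrite (le_trans (ler_normB _ _))// [leRHS]splitr lerD// ltW//.
have e_rho : 2 * eps <= rho / 2 by lra.
have := minimizer_perturb hc speed ep eq e_rho.
rewrite [p + _]addrC [q + _]addrC !subrK => /le_trans; apply; rewrite lerD2l.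
apply: perturb_cost_le => //; first by rewrite !mulr_ge0// invr_ge0 ltW.
exact: le_trans half_rho.
Qed.

Lemma near0_scale (C e : R) : 0 <= C -> 0 < e -> \forall x \near 0^'+, C * x <= e.
Proof.
move=> C0 e0; near=> x.
have x0 : 0 <= x by near: x; exact: nbhs_right_ge.
have : (C + 1) * x <= e; last by lra.
rewrite mulrC -ler_pdivlMr ?ltr_wpDl//; near: x; apply: nbhs_right_le.
by rewrite divr_gt0// ltr_wpDl.
Unshelve. all: by end_near. Qed.

(** The correction [e] of [averaged_curve_energy] is the deviation of the middle of
the geodesic [c] from the middle of the segment, of order [`|z2 - z1| ^+ 2].  Its
cost carries in addition the factor [delta], by which the speeds are bounded. *)
Lemma midpoint_strict_convexity : exists2 delta : R, 0 < delta &
  forall y z1 z2 a b c, in_ball delta y -> in_ball delta z1 -> in_ball delta z2 ->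
    minimizer (rho / 2) z1 y a -> minimizer (rho / 2) z2 y b ->
    minimizer (rho / 2) z1 z2 c ->
    d (c 2^-1) y ^+ 2 <=
      (d z1 y ^+ 2 + d z2 y ^+ 2) / 2 - k ^+ 2 / 16 * `|z2 - z1| ^+ 2.
Proof.
have h16 : (16^-1 : R) + 16^-1 <= 8^-1 by lra.
have [M ME] : exists M, M = L / k by exists (L / k).
have M0 : 0 <= M by rewrite ME divr_ge0// ltW.
have [N NE] : exists N, N = L * (1 + 2 * M) / k ^+ 2 by eexists.
have N0 : 0 <= N.
  by rewrite NE divr_ge0 ?sqr_ge0// mulr_ge0// addr_ge0// mulr_ge0.
pose C1 := L * N * ((2 * M + 4 * N) ^+ 2 + 4 * M + 4 * N).
have C10 : 0 <= C1.
  by rewrite mulr_ge0 ?mulr_ge0// !addr_ge0 ?sqr_ge0 ?mulr_ge0.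
pose C2 := 2 * L * M ^+ 2 + 4 * L * M.
have C20 : 0 <= C2 by rewrite addr_ge0 ?mulr_ge0 ?sqr_ge0.
have k20 : 0 < k ^+ 2 by exact: exprn_gt0.
near (0 : R)^'+ => delta.
have delta0 : 0 < delta by near: delta; exact: nbhs_right_gt.
have delta1 : delta <= 1 by near: delta; exact: nbhs_right_le.
have delta_rho : delta <= rho / 2.
  by near: delta; apply: nbhs_right_le; rewrite divr_gt0.
have N_small : 4 * N * delta <= rho / 2.
  by near: delta; apply: near0_scale; rewrite ?mulr_ge0// divr_gt0.
have C1_small : C1 * delta <= k ^+ 2 / 16.
  by near: delta; apply: near0_scale; rewrite // divr_gt0.
have C2_small : C2 * delta <= k ^+ 2 / 2.
  by near: delta; apply: near0_scale; rewrite // divr_gt0.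
exists delta => // y z1 z2 a b c hy h1 h2 ma mb' mc.
have bhalf p : in_ball delta p -> in_ball (rho / 2) p.
  by move=> hp; exact: lt_le_trans delta_rho.
have dist2 p q : in_ball delta p -> in_ball delta q -> `|q - p| <= 2 * delta.
  move=> hp hq; have -> : q - p = (q - p0) - (p - p0).
    by apply/matrixP => i j; rewrite !mxE; ring.
  rewrite (le_trans (ler_normB _ _))// mulr_natl mulr2n.
  by rewrite lerD// ltW.
have [v vE] : exists v, v = z2 - z1 by eexists.
have v2 : `|v| <= 2 * delta by rewrite vE; exact: dist2.
have half01 : 0 <= (2^-1 : R) <= 1 by rewrite invr_ge0 invf_le1 ?ler1n ?ler0n.
have e_le : `|c 2^-1 - (z1 + 2^-1 *: (z2 - z1))| <= N * `|v| ^+ 2.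
  rewrite vE NE ME.
  exact: (minimizer_near_segment half_rho (bhalf _ h1) (bhalf _ h2) mc half01).
have eps_delta : N * `|v| ^+ 2 <= 4 * N * delta.
  have hv : `|v| ^+ 2 <= (2 * delta) ^+ 2.
    by rewrite lerXn2r ?nnegrE// mulr_ge0// ltW.
  have hd : (2 * delta) ^+ 2 <= 4 * delta.
    rewrite exprMn -natrX ler_wpM2l// expr2 ler_piMl//; exact: ltW.
  by rewrite [4 * N]mulrC -mulrA ler_wpM2l// (le_trans hv).
have [aC a0 a1 aB aE] := ma; have [bC b0 b1 bB bE] := mb'.
have a_speed t : 0 <= t <= 1 -> `|derive1 a t| <= 2 * M * delta.
  move=> t01.
  rewrite (le_trans (minimizer_speed half_rho (bhalf _ h1) (bhalf _ hy) ma t01))//.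
  by rewrite -ME [2 * M]mulrC -mulrA ler_wpM2l// dist2.
have b_speed t : 0 <= t <= 1 -> `|derive1 b t| <= 2 * M * delta.
  move=> t01.
  rewrite (le_trans (minimizer_speed half_rho (bhalf _ h2) (bhalf _ hy) mb' t01))//.
  by rewrite -ME [2 * M]mulrC -mulrA ler_wpM2l// dist2.
have hS : L / 2 * (2 * M * delta) ^+ 2 + 2 * L * (2 * M * delta) <= k ^+ 2 / 2.
  apply: le_trans C2_small.
  have hd : delta ^+ 2 <= delta by rewrite expr2 ler_piMl// ltW.
  have hd2 : 2 * L * M ^+ 2 * delta ^+ 2 <= 2 * L * M ^+ 2 * delta.
    by rewrite ler_wpM2l// ?mulr_ge0 ?sqr_ge0.
  rewrite [leLHS](_ : _ = 2 * L * M ^+ 2 * delta ^+ 2 + 4 * L * M * delta).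
    rewrite [leRHS](_ : _ = 2 * L * M ^+ 2 * delta + 4 * L * M * delta).
      by rewrite lerD2r.
    by rewrite /C2; ring.
  by field.
have := averaged_curve_energy aC bC aB bB aE bE a_speed b_speed _ e_le
  (le_trans eps_delta N_small) hS.
rewrite a1 b1 a0 b0 -vE => /(_ erefl).
have -> : 2^-1 *: (z1 + z2) + (c 2^-1 - (z1 + 2^-1 *: v)) = c 2^-1.
  by rewrite vE; apply/matrixP => i j; rewrite !mxE; field.
move=> /le_trans; apply; rewrite -addrA lerD2l.
have := shift_cost_le L0 M0 N0 (sqr_ge0 `|v|) (ltW delta0) delta1 eps_delta.
have hC1 : C1 * delta * `|v| ^+ 2 <= k ^+ 2 / 16 * `|v| ^+ 2.
  by rewrite ler_wpM2r ?sqr_ge0.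
move=> /le_trans /(_ hC1) hcost.
rewrite lerBlDr (le_trans hcost)// -lerBlDl opprK -mulrDl ler_wpM2r ?sqr_ge0//.
rewrite -mulrDr ler_wpM2l ?(ltW k20)//.
Unshelve. all: by end_near. Qed.

End Distance.

End EnergyEstimates.

(** * Curves on the manifold and their coordinates *)

Section CurvesInCharts.
Variables (R : realType) (n : nat) (M : topologicalType).
Variable G : riemannian_manifold R n M.
Local Notation V := 'rV[R]_n.
Implicit Types (i j : chart_index G) (x y : M) (c : R -> M) (t : R) (s : R -> V).

Lemma chart_domP i (p : V) : (chart i @` dom i) p ->
  dom i (chart_inv i p) /\ chart i (chart_inv i p) = p.
Proof. by move=> [x dx <-]; rewrite chartK. Qed.

Lemma chart_inv_cont i (p : V) : (chart i @` dom i) p ->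
  {for p, continuous (chart_inv i)}.
Proof. by move=> [x dx <-]; exact: chart_inv_continuous. Qed.

Lemma transition_dom_open i j : open (chart i @` (dom i `&` dom j)).
Proof.
rewrite openE => _ [x [dix djx] <-].
have nU : \forall p \near chart i x, (chart i @` dom i) p.
  by apply: open_nbhs_nbhs; split; [exact: codom_open|exists x].
have nJ : \forall p \near chart i x, dom j (chart_inv i p).
  have cx : (chart i @` dom i) (chart i x) by exists x.
  apply: (chart_inv_cont cx); apply: open_nbhs_nbhs.
  by split; [exact: dom_open|rewrite chartK].
apply: filterS2 nU nJ => p /chart_domP[dp ep] jp.
by exists (chart_inv i p).
Qed.

Lemma transition_C1 i j :
  Ck 1 (chart i @` (dom i `&` dom j)) (chart j \o chart_inv i).
Proof. exact (@transition_smooth R n M G i j 1%N). Qed.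

Lemma near_dom i c t : {for t, continuous c} -> dom i (c t) ->
  \forall s \near t, dom i (c s).
Proof.
by move=> cc di; apply: cc; apply: open_nbhs_nbhs; split; [exact: dom_open|].
Qed.

Lemma near_transition i j c t : {for t, continuous c} -> dom i (c t) ->
  \forall s \near t, ((chart j \o chart_inv i) \o (chart i \o c)) s = (chart j \o c) s.
Proof.
by move=> cc di; apply: filterS (near_dom cc di) => s ds /=; rewrite chartK.
Qed.

Lemma chart_change_is_derive i j c t : {for t, continuous c} ->
  dom i (c t) -> dom j (c t) -> derivable (chart i \o c) t 1 ->
  is_derive t 1 (chart j \o c)
    ('D_(derive1 (chart i \o c) t) (chart j \o chart_inv i) (chart i (c t))).
Proof.
move=> cc di dj dc.
have Ui : (chart i @` (dom i `&` dom j)) ((chart i \o c) t) by exists (c t).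
have h := C1_pt_comp_is_derive (transition_C1 i j) Ui dc.
exact (near_eq_is_derive (near_transition j cc di) h).
Qed.

Lemma C1_pt_near_eq (W : normedModType R) (f h : R -> W) t :
  (\forall s \near t, f s = h s) -> C1_pt f t -> C1_pt h t.
Proof.
move=> fh hf; apply: (@C1_pt_near _ _ _ (derive1 f)); last by case: hf.
near=> s; apply: near_eq_is_derive.
  by near: s; exact: near_join fh.
by near: s; exact: C1_pt_near_is_derive.
Unshelve. all: by end_near. Qed.

Lemma chart_change_C1 i j c t : {for t, continuous c} ->
  dom i (c t) -> dom j (c t) -> C1_pt (chart i \o c) t -> C1_pt (chart j \o c) t.
Proof.
move=> cc di dj hc.
have Ui : (chart i @` (dom i `&` dom j)) ((chart i \o c) t) by exists (c t).
have h := C1_pt_comp (@transition_dom_open i j) (transition_C1 i j) Ui hc.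
exact (C1_pt_near_eq (near_transition j cc di) h).
Qed.

(** The square of the speed, computed in the chart [i]. *)
Definition speed2 i c t : R :=
  bil (gram i (chart i (c t))) (derive1 (chart i \o c) t) (derive1 (chart i \o c) t).

Lemma chart_change_speed2 i j c t : {for t, continuous c} ->
  dom i (c t) -> dom j (c t) -> derivable (chart i \o c) t 1 ->
  speed2 i c t = speed2 j c t.
Proof.
move=> cc di dj dc; rewrite /speed2 /bil (gram_compat di dj).
by rewrite (is_derive1_val (chart_change_is_derive cc di dj dc)).
Qed.

Lemma C1_atP c t : C1_at G c t <->
  {for t, continuous c} /\ C1_pt (coords G c t) t.
Proof. by split => [[cc h1 h2]|[cc [h1 h2]]]; [split=> //; split|split]. Qed.

Lemma C1_at_chart i c t : C1_at G c t -> dom i (c t) -> C1_pt (chart i \o c) t.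
Proof.
move=> /C1_atP[cc hc] di.
exact (chart_change_C1 cc (chart_atP G (c t)) di hc).
Qed.

Lemma chart_C1_at i c t : {for t, continuous c} -> dom i (c t) ->
  C1_pt (chart i \o c) t -> C1_at G c t.
Proof.
move=> cc di hc; apply/C1_atP; split; first exact: cc.
exact (chart_change_C1 cc di (chart_atP G (c t)) hc).
Qed.

Lemma speedE i c t : {for t, continuous c} -> dom i (c t) ->
  derivable (chart i \o c) t 1 -> speed G c t = Num.sqrt (speed2 i c t).
Proof.
move=> cc di dc.
by rewrite (chart_change_speed2 cc di (chart_atP G (c t)) dc).
Qed.

Lemma gram_cont i x : dom i x -> {for chart i x, continuous (gram i)}.
Proof.
by move=> dx; apply (@gram_smooth R n M G i 0%N); exists x.
Qed.

Lemma speed2_cont i c t : {for t, continuous c} -> dom i (c t) ->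
  C1_pt (chart i \o c) t -> {for t, continuous (speed2 i c)}.
Proof.
move=> cc di hc; have cd : {for t, continuous (derive1 (chart i \o c))} by case: hc.
apply: cont_bil => //.
apply: (continuous_comp (f := chart i \o c) (g := gram i)).
  exact: C1_pt_cont hc.
exact: gram_cont.
Qed.

Lemma C1_at_cont c t : C1_at G c t -> {for t, continuous c}.
Proof. by case. Qed.

(** [speed] reads the velocity in a chart that depends on the time; around a given
time a single chart will do, because the curve stays in its domain, where it is
continuous since its coordinates are. *)
Lemma near_speedE i c t : C1_at G c t -> dom i (c t) ->
  \forall s \near t, speed G c s = Num.sqrt (speed2 i c s).
Proof.
move=> hc di; have cc := C1_at_cont hc.
have hi := C1_at_chart hc di.
near=> s.
have ds : dom i (c s) by near: s; exact: near_dom.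
have nds : \forall u \near s, dom i (c u) by near: s; exact: near_join (near_dom cc di).
have dcs : derivable (chart i \o c) s 1 by near: s; case: hi.
apply: speedE => //.
have e : \forall u \near s, c u = (chart_inv i \o (chart i \o c)) u.
  by apply: filterS nds => u du /=; rewrite chartK.
apply: cont_near_eq e _; apply: continuous_comp; first exact: derivable_cont.
exact: chart_inv_continuous.
Unshelve. all: by end_near. Qed.

Lemma speed_cont c t : C1_at G c t -> {for t, continuous (speed G c)}.
Proof.
move=> hc; have di := chart_atP G (c t); have cc := C1_at_cont hc.
apply: cont_near_eq (near_speedE hc di) _.
apply: (continuous_comp (g := Num.sqrt)); last exact: sqrt_continuous.
by apply: speed2_cont => //; exact: C1_at_chart.
Qed.

Lemma speed_ge0 c t : 0 <= speed G c t.
Proof. exact: sqrtr_ge0. Qed.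

Lemma curve_length_ge0 c : (0 <= curve_length G c)%E.
Proof. by apply: integral_ge0 => t _; rewrite lee_fin speed_ge0. Qed.

Lemma rdist_ge0 x y : (0 <= rdist G x y)%E.
Proof. by apply: le_ereal_inf_tmp => _ [c _ <-]; exact: curve_length_ge0. Qed.

Lemma C1_piecewise c : (forall t, 0 <= t <= 1 -> C1_at G c t) -> piecewise_C1 G c.
Proof.
move=> hc; split; first by apply: cont_on_within => t /hc/C1_at_cont.
exists 1%N, (fun k => k%:R); split => // -[|//] _; split; first exact: ltr01.
by exists c => s s01; split => //; exact: hc.
Qed.

Lemma C1_curve_length c : (forall t, 0 <= t <= 1 -> C1_at G c t) ->
  curve_length G c = (mean (speed G c))%:E.
Proof. by move=> hc; rewrite EFin_mean// => t /hc/speed_cont. Qed.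

Section ChartCurve.
Variables (i : chart_index G) (s : R -> V).
Hypotheses (sC : C1_on s) (sU : forall t, 0 <= t <= 1 -> (chart i @` dom i) (s t)).

Lemma near_chart_inv t : 0 <= t <= 1 ->
  \forall u \near t, s u = (chart i \o (chart_inv i \o s)) u.
Proof.
move=> t01; have : \forall u \near t, (chart i @` dom i) (s u).
  apply: (C1_pt_cont (sC t01)); apply: open_nbhs_nbhs.
  by split; [exact: codom_open|exact: sU].
by apply: filterS => u /chart_domP[_ /= ->].
Qed.

Lemma chart_inv_curve_cont t : 0 <= t <= 1 -> {for t, continuous (chart_inv i \o s)}.
Proof.
move=> t01; apply: continuous_comp; first exact: C1_pt_cont (sC t01).
exact/chart_inv_cont/sU.
Qed.

Lemma chart_inv_curve_C1 t : 0 <= t <= 1 -> C1_at G (chart_inv i \o s) t.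
Proof.
move=> t01; have [dt et] := chart_domP (sU t01).
apply: (chart_C1_at (chart_inv_curve_cont t01) dt).
exact (C1_pt_near_eq (near_chart_inv t01) (sC t01)).
Qed.

Lemma chart_inv_curve_speed t : 0 <= t <= 1 ->
  speed G (chart_inv i \o s) t = Num.sqrt (energy_density (gram i) s t).
Proof.
move=> t01; have [dt et] := chart_domP (sU t01).
have hd := near_eq_is_derive (near_chart_inv t01) (C1_pt_is_derive (sC t01)).
have [dc _] := hd.
rewrite (speedE (chart_inv_curve_cont t01) dt dc).
by rewrite /speed2 (is_derive1_val hd) [chart i _]et.
Qed.

(** This is how a test curve in coordinates bounds the distance. *)
Lemma rdist_chart_curve :
  (rdist G (chart_inv i (s 0)) (chart_inv i (s 1)) <=
    (mean (fun t => Num.sqrt (energy_density (gram i) s t)))%:E)%E.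
Proof.
have hC := chart_inv_curve_C1.
apply: ge_ereal_inf; exists (curve_length G (chart_inv i \o s)).
  by exists (chart_inv i \o s); [split; [exact: C1_piecewise| |]|].
have -> : curve_length G (chart_inv i \o s) =
    (mean (fun t => Num.sqrt (energy_density (gram i) s t)))%:E.
  exact (etrans (C1_curve_length hC) (congr1 EFin (mean_eq chart_inv_curve_speed))).
exact: lexx.
Qed.

End ChartCurve.

End CurvesInCharts.

(** * Geodesics have constant speed *)

Section GeodesicSpeed.
Variables (R : realType) (n : nat) (M : topologicalType).
Variable G : riemannian_manifold R n M.
Local Notation V := 'rV[R]_n.
Implicit Types (i j : chart_index G) (x y : M) (c : R -> M) (t : R).

Lemma posdef_unitmx (A : 'M[R]_n) :
  (forall v : V, v != 0 -> 0 < bil A v v) -> A \in unitmx.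
Proof.
move=> Apos; rewrite unitmxE unitfE; apply/det0P => -[v v0 vA].
by have := Apos v v0; rewrite /bil vA mul0mx mxE ltxx.
Qed.

Lemma gram_unitmx i x : dom i x -> gram i (chart i x) \in unitmx.
Proof. by move=> dx; apply: posdef_unitmx => v; exact: gram_pos. Qed.

Lemma speed2_ge0 i c t : dom i (c t) -> 0 <= speed2 i c t.
Proof.
move=> di; rewrite /speed2; set v := derive1 _ _.
have [->|v0] := eqVneq v 0; first by rewrite /bil !mul0mx mxE.
exact/ltW/gram_pos.
Qed.

Lemma geodesic_at_C1 c t : geodesic_at G c t -> C1_at G c t.
Proof.
case=> cc dg ddg _; split; first exact cc.
  exact dg.
exact (derivable_cont ddg).
Qed.

Lemma sum3_rot (f : 'I_n -> 'I_n -> 'I_n -> R) :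
  \sum_a \sum_b \sum_l f a b l = \sum_a \sum_b \sum_l f l a b.
Proof.
rewrite exchange_big /=.
under eq_bigr do rewrite exchange_big /=.
by rewrite exchange_big.
Qed.

(** The algebra behind the conservation of speed: contracted with three copies
of the velocity [v], the three terms of the Christoffel symbol coincide up to
sign, and the Gram matrix cancels against its inverse. *)
Lemma christoffel_contraction (A : 'M[R]_n) (d : 'I_n -> 'I_n -> 'I_n -> R) (v w : V) :
  A \in unitmx -> A^T = A ->
  (forall k, w 0 k + \sum_a \sum_b
     (2^-1 * \sum_l invmx A k l * (d a b l + d b a l - d l a b)) * v 0 a * v 0 b = 0) ->
  bil A w v = - 2^-1 * \sum_a \sum_b \sum_l d a b l * v 0 a * v 0 b * v 0 l.
Proof.
move=> uA sA hw.
pose tau : V := \row_l \sum_a \sum_b (d a b l + d b a l - d l a b) * v 0 a * v 0 b.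
have wE : w = - 2^-1 *: (tau *m invmx A).
  apply/rowP => k; move/eqP: (hw k); rewrite addr_eq0 => /eqP ->.
  rewrite !mxE mulNr; congr (- _); rewrite mulr_sumr.
  transitivity (\sum_a \sum_b \sum_l
      2^-1 * (invmx A k l * ((d a b l + d b a l - d l a b) * v 0 a * v 0 b))).
    apply: eq_bigr => a _; apply: eq_bigr => b _.
    by rewrite mulr_sumr !mulr_suml; apply: eq_bigr => l _; ring.
  rewrite -sum3_rot; apply: eq_bigr => l _.
  rewrite mxE mulr_suml mulr_sumr; apply: eq_bigr => a _.
  rewrite mulr_suml mulr_sumr; apply: eq_bigr => b _.
  have -> : invmx A l k = invmx A k l by rewrite -[in LHS]sA -trmx_inv mxE.
  by ring.
rewrite wE bilZl /bil (mulmxKV uA) mxE; congr (_ * _).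
pose f a b l := d a b l * v 0 a * v 0 b * v 0 l.
transitivity (\sum_l \sum_a \sum_b (f a b l + f b a l - f l a b)).
  apply: eq_bigr => l _; rewrite !mxE mulr_suml; apply: eq_bigr => a _.
  by rewrite mulr_suml; apply: eq_bigr => b _; rewrite /f; ring.
rewrite (eq_bigr (fun l => \sum_a \sum_b f a b l + \sum_a \sum_b f b a l
    - \sum_a \sum_b f l a b)); last first.
  move=> l _; rewrite -!sumrN -!big_split /=; apply: eq_bigr => a _.
  by rewrite -!sumrN -!big_split.
rewrite !big_split /= sumrN.
have e1 : \sum_l \sum_a \sum_b f a b l = \sum_a \sum_b \sum_l f a b l.
  exact: (sum3_rot (fun l a b => f a b l)).
have e2 : \sum_l \sum_a \sum_b f b a l = \sum_a \sum_b \sum_l f a b l.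
  by rewrite -e1; apply: eq_bigr => l _; rewrite exchange_big.
by rewrite e1 e2 addrK.
Qed.

(** The geodesic equation is only known in the preferred chart at [c t], which
varies with [t]; computing the derivative at [t] in that very chart avoids the
transformation law of the Christoffel symbols. *)
Lemma geodesic_speed2_derive c t : geodesic_at G c t ->
  is_derive t 1 (speed2 (chart_at G (c t)) c) 0.
Proof.
move=> hg; have [cc dg ddg hk] := hg; set j := chart_at G (c t) in dg ddg hk *.
have dj : dom j (c t) by exact: chart_atP.
have jU : (chart j @` dom j) (coords G c t t) by exists (c t).
set g := coords G c t in dg ddg hk jU *; set v := derive1 g t.
have gC1 : Ck 1 (chart j @` dom j) (gram j) by exact (@gram_smooth R n M G j 1%N).
have hA := C1_pt_comp_is_derive gC1 jU (nbhs_singleton dg).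
have hv : is_derive t 1 (derive1 g) (derive1 (derive1 g) t).
  by rewrite [X in is_derive _ _ _ X]derive1E; exact: DeriveDef.
have hb := is_derive_bil hA hv hv.
apply: (is_derive_eq hb); rewrite -/v.
have sA : (gram j (g t))^T = gram j (g t) by exact: gram_sym.
rewrite [(gram j \o g) t]/= (bilC v _ sA).
have uA : gram j (g t) \in unitmx by exact: gram_unitmx.
pose d a b l := 'D_(delta_mx 0 a) (fun q => gram j q b l) (g t).
rewrite (christoffel_contraction (d := d) uA sA hk).
have -> : bil ('D_v (gram j) (g t)) v v =
    \sum_a \sum_b \sum_l d a b l * v 0 a * v 0 b * v 0 l.
  rewrite bilE [RHS]sum3_rot; apply: eq_bigr => b _.
  apply: eq_bigr => l _; rewrite (derive_partials gC1)// summxE mulr_sumr mulr_suml.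
  apply: eq_bigr => a _; rewrite !mxE /d.
  have -> : 'D_(delta_mx 0 a) (gram j) (g t) b l =
      'D_(delta_mx 0 a) (fun q => gram j q b l) (g t).
    rewrite derive_mx ?mxE//; apply: diff_derivable.
    by case: gC1 => + _; exact.
  by rewrite -/v; ring.
by field.
Qed.

Lemma geodesic_constant_speed c t : geodesic G c -> 0 <= t <= 1 ->
  speed G c t = speed G c 0.
Proof.
move=> hc t01; pose F u := speed G c u ^+ 2.
have dF (u : R) : 0 <= u <= 1 -> is_derive u 1 F 0.
  move=> u01; have hu := hc u u01; have C1u := geodesic_at_C1 hu.
  apply: near_eq_is_derive (geodesic_speed2_derive hu).
  apply: filterS2 (near_speedE C1u (chart_atP G (c u)))
    (near_dom (C1_at_cont C1u) (chart_atP G (c u))) => s es ds.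
  by rewrite /F es (sqr_sqrtr (speed2_ge0 ds)).
have c0 : @cont_on R R 0 1 (fun=> 0) by exact: cont_on_cst.
have z01 : 0 <= (0 : R) <= 1 by rewrite lexx ler01.
have := increment_le_mean z01 t01 dF c0 c0.
rewrite mean_cst normr0 => /(_ (fun _ _ => lexx _)); rewrite normr_le0 subr_eq0.
rewrite /F (eqrXn2 (ltn0Sn 1) (speed_ge0 G c t) (speed_ge0 G c 0)).
exact: eqP.
Qed.

Lemma minimal_geodesic_chart i x y c : minimal_geodesic G x y c ->
  (forall t, 0 <= t <= 1 -> dom i (c t)) ->
  C1_on (chart i \o c) /\ forall t, 0 <= t <= 1 ->
    energy_density (gram i) (chart i \o c) t = fine (rdist G x y) ^+ 2.
Proof.
move=> [gc _ _ lc] dc.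
have hC t : 0 <= t <= 1 -> C1_at G c t by move=> t01; exact: geodesic_at_C1 (gc t t01).
have iC : C1_on (chart i \o c).
  by move=> t t01; exact (C1_at_chart (hC t t01) (dc t t01)).
split; [exact iC|move=> t t01; rewrite -lc (C1_curve_length hC) /=].
rewrite (mean_eq (g := fun=> speed G c 0)); last first.
  by move=> s s01; exact: geodesic_constant_speed.
rewrite mean_cst -(geodesic_constant_speed gc t01).
rewrite (speedE (C1_at_cont (hC t t01)) (dc t t01) (C1_pt_derivable (iC t t01))).
by rewrite (sqr_sqrtr (speed2_ge0 (dc t t01))).
Qed.

End GeodesicSpeed.

(** * Short curves stay in a chart *)

Section PiecewiseIncrement.
Variable R : realType.
Local Notation mu := (@lebesgue_measure R).
Implicit Types (F f h : R -> R).

(** The values of [F] at the ends and those of [h] inside the interval are taken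
from functions that behave well up to the ends, as in the definition of
[piecewise_C1]. *)
Definition increment_bounded_on a b F h := exists F' f' h' : R -> R,
  [/\ forall u : R, a <= u <= b -> is_derive u 1 F' (f' u),
      cont_on a b f', cont_on a b h' & forall u, a <= u <= b -> `|f' u| <= h' u] /\
  [/\ F a = F' a, F b = F' b & forall u, a < u < b -> h u = h' u].

Lemma piece_measurable a b F h : increment_bounded_on a b F h ->
  measurable_fun `]a, b[ h.
Proof.
move=> [F' [f' [h' [[dF cf ch fh] [_ _ hh]]]]].
apply: (@eq_measurable_fun _ _ _ _ _ h').
  by move=> u /set_mem /=; rewrite in_itv /= => /hh ->.
apply: measurable_funS (cont_on_measurable ch) => //.
by apply: subset_itvW.
Qed.

Lemma piece_increment_le a b F h : a < b -> increment_bounded_on a b F h ->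
  (`|F b - F a|%:E <= \int[mu]_(u in `[a, b[) (h u)%:E)%E.
Proof.
move=> ab hb; have mh := piece_measurable hb.
move: hb => [F' [f' [h' [[dF cf ch fh] [-> -> hh]]]]].
rewrite integral_itv_bndoo; last exact/measurable_EFinP.
have -> : (\int[mu]_(u in `]a, b[) (h u)%:E = \int[mu]_(u in `]a, b[) (h' u)%:E)%E.
  by apply: eq_integral => u /set_mem /=; rewrite in_itv /= => /hh ->.
rewrite -(@integral_itv_bndoo _ _ _ _ true false); last first.
  apply/measurable_EFinP; apply: measurable_funS (cont_on_measurable ch) => //.
  by apply: subset_itvW.
exact: increment_le_integral (ltW ab) dF cf ch fh.
Qed.

Lemma piecewise_increment_le (N : nat) (t : nat -> R) F h :
  (forall u, 0 <= h u) -> (forall k, (k < N)%N -> t k < t k.+1) ->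
  (forall k, (k < N)%N -> increment_bounded_on (t k) (t k.+1) F h) ->
  (`|F (t N) - F (t 0%N)|%:E <= \int[mu]_(u in `[t 0%N, t N]) (h u)%:E)%E.
Proof.
move=> h0 tS tB.
suff [_ mh hi] : [/\ t 0%N <= t N, measurable_fun `[t 0%N, t N[ h &
    (`|F (t N) - F (t 0%N)|%:E <= \int[mu]_(u in `[t 0%N, t N[) (h u)%:E)%E].
  by rewrite -integral_itv_bndo_bndc//; exact/measurable_EFinP.
elim: N tS tB => [|N IH] tS tB.
  split => //; first by rewrite set_itvco0; exact: measurable_fun_set0.
  by rewrite subrr normr0 set_itvco0 integral_set0.
have [||le mh hi] := IH; [by move=> k kN; apply: tS; exact: ltnW|
  by move=> k kN; apply: tB; exact: ltnW|].
have tN := tS N (ltnSn N); have bN := tB N (ltnSn N).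
have U : `[t 0%N, t N.+1[%classic = `[t 0%N, t N[ `|` `[t N, t N.+1[.
  by apply: itv_bndbnd_setU; rewrite bnd_simp ?(ltW tN).
have mB : measurable_fun `[t N, t N.+1[ h.
  exact: measurable_fun_itv_co (piece_measurable bN).
have mU : measurable_fun (`[t 0%N, t N[ `|` `[t N, t N.+1[) h.
  by apply/measurable_funU.
split; [exact: le_trans (ltW tN)|by rewrite U|].
rewrite U ge0_integral_setU//; last 3 first.
- exact/measurable_EFinP.
- by move=> u _; rewrite lee_fin.
- rewrite disj_set2E; apply/eqP/seteqP; split => // u /=.
  by rewrite !in_itv /= => -[/andP[_ u1] /andP[u2 _]]; move: (lt_le_trans u1 u2); rewrite ltxx.
apply: (@le_trans _ _ (`|F (t N) - F (t 0%N)|%:E + `|F (t N.+1) - F (t N)|%:E)%E).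
  have -> : F (t N.+1) - F (t 0%N) = (F (t N) - F (t 0%N)) + (F (t N.+1) - F (t N)).
    by ring.
  by rewrite -EFinD lee_fin ler_normD.
by apply: leeD => //; exact: piece_increment_le.
Qed.

End PiecewiseIncrement.

Section PositivePartSquare.
Variable R : realType.
Implicit Types z : R.

(** Squaring makes the positive part continuously differentiable at zero. *)
Definition pos_sqr z : R := Num.max 0 z ^+ 2.

Lemma pos_sqr_le z : pos_sqr z <= z ^+ 2.
Proof.
rewrite /pos_sqr; have [z0|z0] := leP 0 z; first exact: lexx.
by rewrite expr0n sqr_ge0.
Qed.

Lemma is_derive_pos_sqr z : is_derive z 1 pos_sqr (2 * Num.max 0 z).
Proof.
have [z0|z0|->] := ltgtP z 0.
- rewrite mulr0; apply: (near_eq_is_derive _ (is_derive_cst (0 : R) z 1)).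
  near=> u; rewrite /pos_sqr max_l ?expr0n//.
  by apply: ltW; near: u; exact: lt_nbhsl.
- have h : is_derive z 1 (fun u : R => u ^+ 2) (2 * z).
    apply: DeriveDef; first exact: exprn_derivable.
    by rewrite exp_derive expr1 /GRing.scale /= mulr1.
  apply: (near_eq_is_derive _ h).
  near=> u; rewrite /pos_sqr max_r//.
  by apply: ltW; near: u; exact: lt_nbhsr.
- rewrite mulr0.
  have h : h^-1 *: ((pos_sqr \o shift 0) (h *: 1) - pos_sqr 0) @[h --> 0^'] --> (0 : R).
    apply/cvgr0Pnorm_lt => e e0; near=> h.
    rewrite /= addr0 /GRing.scale /= mulr1 {2}/pos_sqr maxxx expr0n subr0 normrM normfV.
    have hn0 : h != 0 by near: h; exact: nbhs_dnbhs_neq.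
    rewrite mulrC ltr_pdivrMr ?normr_gt0// ger0_norm ?sqr_ge0//.
    apply: (le_lt_trans (pos_sqr_le h)); rewrite -real_normK ?num_real// expr2.
    by rewrite ltr_pM2r ?normr_gt0//; near: h; exact: dnbhs0_lt.
  by apply: DeriveDef; [apply/cvg_ex; exists 0|exact: cvg_lim h].
Unshelve. all: by end_near. Qed.

End PositivePartSquare.

Section Bump.
Variables (R : realType) (n : nat) (M : topologicalType).
Variable G : riemannian_manifold R n M.
Local Notation V := 'rV[R]_n.
Variables (i : chart_index G) (p0 : V) (rho k : R).
Hypotheses (rho0 : 0 < rho) (k0 : 0 < k).
Hypothesis ballU : forall p, `|p - p0| <= rho -> (chart i @` dom i) p.
Hypothesis gram_lower : forall p (v : V), `|p - p0| <= rho ->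
  k ^+ 2 * `|v| ^+ 2 <= bil (gram i p) v v.
Implicit Types (c : R -> M) (y : M) (t : R) (w : V).

Definition sqnorm w := bil 1%:M w w.

Lemma sqnormE w : sqnorm w = \sum_j w 0 j ^+ 2.
Proof.
rewrite /sqnorm /bil mulmx1 mxE; apply: eq_bigr => j _.
by rewrite mxE expr2.
Qed.

Lemma norm_sqnorm w (r : R) : 0 <= r -> sqnorm w <= r ^+ 2 -> `|w| <= r.
Proof.
move=> r0 wr; apply: mx_norm_le => // a j; rewrite (ord1 a).
rewrite -(@ler_pXn2r _ 2) ?nnegrE// real_normK ?num_real//.
apply: le_trans wr; rewrite sqnormE (bigD1 j)//= lerDl.
by apply: sumr_ge0 => l _; exact: sqr_ge0.
Qed.

Definition bump_arg p := 1 - sqnorm (p - p0) / rho ^+ 2.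

(** Equal to one at the point of coordinates [p0], and vanishing outside a compact
part of the chart domain, so that extending it by zero keeps it [C1]. *)
Definition bump y : R := if `[< dom i y >] then pos_sqr (bump_arg (chart i y)) else 0.

Definition bump_support : set M :=
  chart_inv i @` [set p | sqnorm (p - p0) <= rho ^+ 2].

(** A compact subset of a Hausdorff space is closed: this is where the manifold
being Hausdorff matters, as it prevents a curve from leaving the chart without
the bump function noticing. *)
Lemma bump_support_closed : closed bump_support.
Proof.
apply: (compact_closed (manifold_hausdorff G)).
have sub p : sqnorm (p - p0) <= rho ^+ 2 -> `|p - p0| <= rho.
  by apply: norm_sqnorm; exact: ltW.
apply: continuous_compact.
  by apply: continuous_in_subspaceT => p /set_mem /= /sub/ballU/chart_inv_cont.
apply: bounded_closed_compact.
  exists (rho + `|p0|); split; first exact: num_real.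
  move=> x hx p /= /sub h; rewrite -(subrK p0 p).
  by rewrite (le_trans (ler_normD _ _))// (le_trans _ (ltW hx))// lerD2r.
have -> : [set p | sqnorm (p - p0) <= rho ^+ 2] =
    (fun p : V => sqnorm (p - p0)) @^-1` [set x | x <= rho ^+ 2] by [].
apply: closed_comp; last exact: closed_le.
have cs (p : V) : {for p, continuous (fun q : V => q - p0)}.
  by apply: (continuousB (f := id) (g := fun=> p0)); [exact: cvg_id|exact: cst_continuous].
move=> p _; apply: (@cont_bil _ _ _ (fun=> 1%:M) (fun q : V => q - p0) (fun q : V => q - p0)).
- exact: cst_continuous.
- exact: cs.
- exact: cs.
Qed.

Lemma bump_out y : ~ bump_support y -> bump y = 0.
Proof.
move=> nK; rewrite /bump; case: asboolP => // dy.
rewrite /pos_sqr max_l ?expr0n//.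
rewrite /bump_arg subr_le0 ler_pdivlMr ?exprn_gt0// mul1r.
rewrite leNgt; apply/negP => h; apply: nK; exists (chart i y); last exact: chartK.
exact: ltW.
Qed.

Let m : R := (n ^ 2)%:R * `|1%:M : 'M[R]_n|.
Definition bump_const : R := 4 * (m + 1) / (rho * k).

Lemma bump_const_gt0 : 0 < bump_const.
Proof. by rewrite divr_gt0 ?mulr_gt0// ltr_wpDl// mulr_ge0. Qed.

Lemma bump_arg_le1 p : bump_arg p <= 1.
Proof.
rewrite /bump_arg gerDl oppr_le0 divr_ge0 ?sqr_ge0// sqnormE.
by apply: sumr_ge0 => j _; exact: sqr_ge0.
Qed.

(** Where the curve is in the chart domain, differentiate in coordinates; elsewhere
it avoids the closed support, so the bump function vanishes along it. *)
Lemma bump_curve c t : C1_at G c t ->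
  C1_pt (bump \o c) t /\ `|derive1 (bump \o c) t| <= bump_const * speed G c t.
Proof.
move=> hc; have cc := C1_at_cont hc.
have [di|ndi] := pselect (dom i (c t)); last first.
  have nK : ~ bump_support (c t).
    by move=> [p /(norm_sqnorm (ltW rho0))/ballU/chart_domP[dp _] e]; apply: ndi; rewrite -e.
  have e : \forall s \near t, (fun=> 0 : R) s = (bump \o c) s.
    have : \forall s \near t, ~ bump_support (c s).
      apply: (cc (~` bump_support)); apply: open_nbhs_nbhs; split; last exact: nK.
      by rewrite openC; exact: bump_support_closed.
    by apply: filterS => s /bump_out /= ->.
  split; first exact: C1_pt_near_eq e (C1_pt_cst _ _).
  rewrite (is_derive1_val (near_eq_is_derive e (is_derive_cst 0 t 1))) normr0.
  by rewrite mulr_ge0 ?speed_ge0// ltW// bump_const_gt0.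
pose phi := chart i \o c; have hphi : C1_pt phi t := C1_at_chart hc di.
pose a (s : R) : R := bump_arg (phi s).
pose da (s : R) : R := - ((bil 1%:M (derive1 phi s) (phi s - p0)
  + bil 1%:M (phi s - p0) (derive1 phi s)) / rho ^+ 2).
have e : \forall s \near t, (@pos_sqr R \o a) s = (bump \o c) s.
  by apply: filterS (near_dom cc di) => s ds; rewrite /= /bump asboolT.
have dw (s : R) : derivable phi s 1 -> is_derive s 1 (fun s => phi s - p0) (derive1 phi s).
  move=> dphi; rewrite -[X in is_derive _ _ _ X]subr0.
  by apply: (is_deriveB (g := cst p0)); rewrite derive1E; exact: DeriveDef.
have dwa (s : R) : derivable phi s 1 -> is_derive s 1 a (da s).
  move=> /dw hw; have hb := is_derive_bil (is_derive_cst 1%:M s 1) hw hw.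
  have hz := is_deriveZ (rho ^- 2) hb.
  have := is_deriveB (is_derive_cst (1 : R) s 1) hz.
  rewrite (_ : cst 1 - _ = a); last first.
    by apply/funext => u; rewrite /a /bump_arg /sqnorm mulrC.
  move/is_derive_eq; apply.
  rewrite /da [bil 0 _ _](_ : _ = 0) ?add0r; last by rewrite /bil mulmx0 mul0mx mxE.
  by rewrite ?add0r; congr (- _); rewrite mulrC.
have dwp (s : R) : derivable phi s 1 ->
    is_derive s 1 (@pos_sqr R \o a) (2 * Num.max 0 (a s) * da s).
  by move=> /dwa ?; apply: is_derive1_comp; exact: is_derive_pos_sqr.
have cphi : {for t, continuous (fun s => phi s - p0)}.
  by apply: cvgB; [exact: C1_pt_cont hphi|exact: cst_continuous].
have cdphi : {for t, continuous (derive1 phi)} by case: hphi.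
have c1 : {for t, continuous (fun _ : R => 1%:M : 'M[R]_n)} by exact: cst_continuous.
have ca : {for t, continuous a}.
  by apply: derivable_cont; have [] := dwa t (C1_pt_derivable hphi).
have cda : {for t, continuous da}.
  apply: cvgN; apply: cvgM; last exact: cst_continuous.
  exact (cvgD (cont_bil c1 cdphi cphi) (cont_bil c1 cphi cdphi)).
have hP : C1_pt (@pos_sqr R \o a) t.
  apply: (C1_pt_near (df := fun s => 2 * Num.max 0 (a s) * da s)).
    by apply: filterS hphi.1 => s; exact: dwp.
  have cmax : {for t, continuous (fun s => Num.max 0 (a s))}.
    exact (continuous_max (@cst_continuous R R 0 t) ca).
  have c2 : {for t, continuous (fun _ : R => 2 : R)} by exact: cst_continuous.
  exact (cvgM (cvgM c2 cmax) cda).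
split; first exact: C1_pt_near_eq e hP.
have hd := near_eq_is_derive e (dwp t (C1_pt_derivable hphi)).
rewrite (is_derive1_val hd).
have dphi : derivable phi t 1 := C1_pt_derivable hphi.
rewrite (speedE cc di dphi).
have [a0|a0] := leP (a t) 0.
  rewrite mulr0 mul0r normr0 mulr_ge0 ?sqrtr_ge0//.
  exact/ltW/bump_const_gt0.
have w_le : `|phi t - p0| <= rho.
  apply: norm_sqnorm; first exact: ltW.
  by move: a0; rewrite /a /bump_arg subr_gt0 ltr_pdivrMr ?exprn_gt0// mul1r => /ltW.
have spd : k * `|derive1 phi t| <= Num.sqrt (speed2 i c t).
  rewrite -(@ler_pXn2r _ 2) ?nnegrE ?sqrtr_ge0 ?mulr_ge0 ?(ltW k0)//.
  have hl := gram_lower (derive1 phi t) w_le.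
  rewrite exprMn sqr_sqrtr; first exact hl.
  by apply: le_trans hl; rewrite mulr_ge0 ?sqr_ge0.
have m0 : 0 <= m by rewrite mulr_ge0.
have da_le : `|da t| <= 2 * m * `|derive1 phi t| / rho.
  rewrite /da normrN normrM normfV [`|rho ^+ 2|]ger0_norm ?sqr_ge0//.
  rewrite ler_pdivrMr ?exprn_gt0//.
  have -> : 2 * m * `|derive1 phi t| / rho * rho ^+ 2 =
      m * `|derive1 phi t| * rho + m * rho * `|derive1 phi t|.
    by field; exact: lt0r_neq0.
  rewrite (le_trans (ler_normD _ _))// lerD//; apply: (le_trans (bil_norm _ _ _)).
    by rewrite -/m ler_wpM2l ?mulr_ge0.
  by rewrite -/m ler_wpM2r// ler_wpM2l.
rewrite normrM ger0_norm ?mulr_ge0 ?(ltW a0)//.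
have a1 : a t <= 1 by exact: bump_arg_le1.
apply: (@le_trans _ _ (2 * 1 * (2 * m * `|derive1 phi t| / rho))).
  by apply: ler_pM; rewrite ?mulr_ge0 ?(ltW a0) ?ler_wpM2l.
apply: (@le_trans _ _ (bump_const * (k * `|derive1 phi t|))); last first.
  by rewrite ler_wpM2l// ltW// bump_const_gt0.
have -> : bump_const * (k * `|derive1 phi t|) =
    4 * (m + 1) * `|derive1 phi t| / rho.
  by rewrite /bump_const; field; rewrite !lt0r_neq0.
have -> : 2 * 1 * (2 * m * `|derive1 phi t| / rho) =
    4 * m * `|derive1 phi t| / rho by field; exact: lt0r_neq0.
rewrite ler_wpM2r ?invr_ge0 ?(ltW rho0)// ler_wpM2r// ler_wpM2l//.
by rewrite lerDl ler01.
Qed.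

Lemma speed_near_eq (b c : R -> M) (t : R) : (\forall u \near t, b u = c u) ->
  speed G b t = speed G c t.
Proof.
move=> bc; have e := nbhs_singleton bc.
rewrite /speed /coords e.
have -> : derive1 (chart (chart_at G (c t)) \o b) t =
          derive1 (chart (chart_at G (c t)) \o c) t.
  rewrite !derive1E; apply: near_eq_derive.
  by apply: filterS bc => u /= ->.
by [].
Qed.

Lemma piecewise_bump c : piecewise_C1 G c ->
  (`|bump_const^-1 * bump (c 1) - bump_const^-1 * bump (c 0)|%:E <= curve_length G c)%E.
Proof.
move=> [_ [N [t [t0 tN tb]]]].
rewrite /curve_length -tN -t0.
apply: (piecewise_increment_le (F := fun u => bump_const^-1 * bump (c u))).
- by move=> u; exact: speed_ge0.
- by move=> j jN; have [] := tb j jN.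
move=> j jN; have [tj [b hb]] := tb j jN.
have hC u : t j <= u <= t j.+1 -> C1_at G b u by move=> /hb[].
have e u : t j <= u <= t j.+1 -> b u = c u by move=> /hb[].
exists (fun u => bump_const^-1 * bump (b u)).
exists (fun u => bump_const^-1 * derive1 (bump \o b) u), (speed G b).
split; split.
- move=> u /hC/bump_curve[/C1_pt_is_derive hd _].
  exact: (is_deriveZ bump_const^-1 hd).
- move=> u /hC/bump_curve[[_ hd] _].
  exact: (cvgM (@cst_continuous R R bump_const^-1 u) hd).
- by move=> u /hC; exact: speed_cont.
- move=> u /hC/bump_curve[_ hd].
  rewrite normrM ger0_norm ?invr_ge0 ?(ltW bump_const_gt0)//.
  by rewrite ler_pdivrMl ?bump_const_gt0.
- by rewrite e ?lexx ?(ltW tj).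
- by rewrite e ?lexx ?(ltW tj).
- move=> u /andP[tu ut]; apply: speed_near_eq.
  have h1 : \forall s \near u, t j < s by exact: lt_nbhsr.
  have h2 : \forall s \near u, s < t j.+1 by exact: lt_nbhsl.
  by apply: filterS2 h1 h2 => s /ltW s1 /ltW s2; rewrite e ?s1.
Qed.

Lemma bump_rdist x y :
  ((bump_const^-1 * `|bump y - bump x|)%:E <= rdist G x y)%E.
Proof.
apply: le_ereal_inf_tmp => _ [c [hc <- <-] <-].
apply: le_trans (piecewise_bump hc).
rewrite -mulrBr normrM (ger0_norm (_ : 0 <= bump_const^-1)) ?lexx//.
by rewrite invr_ge0 ltW// bump_const_gt0.
Qed.

Lemma bump_gt0_in y : 0 < bump y -> dom i y /\ `|chart i y - p0| <= rho.
Proof.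
rewrite /bump; case: asboolP => [dy|_]; last by rewrite ltxx.
rewrite /pos_sqr; have [a0|a0] := leP (bump_arg (chart i y)) 0.
  by rewrite expr0n ltxx.
move=> _; split=> //; apply: norm_sqnorm; first exact: ltW.
by move: a0; rewrite /bump_arg subr_gt0 ltr_pdivrMr ?exprn_gt0// mul1r => /ltW.
Qed.

Lemma bump_near_center : exists2 d : R, 0 < d & forall y, dom i y ->
  `|chart i y - p0| < d -> 4^-1 <= bump y.
Proof.
have m0 : 0 <= m by rewrite mulr_ge0.
(* Within this radius [bump_arg] is at least [2^-1], whose square is [4^-1]. *)
exists (rho / (2 * (m + 1))); first by rewrite divr_gt0// mulr_gt0// ltr_wpDl.
move=> y dy hy; rewrite /bump asboolT// /pos_sqr.
set w := chart i y - p0 in hy *.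
have h : sqnorm w <= rho ^+ 2 / 2.
  rewrite (le_trans (ler_norm _))// (le_trans (bil_norm _ _ _))// -/m -mulrA -expr2.
  have : `|w| ^+ 2 <= (rho / (2 * (m + 1))) ^+ 2.
    rewrite lerXn2r ?nnegrE//; last exact: ltW.
    by rewrite divr_ge0 ?mulr_ge0 ?addr_ge0// ltW.
  move=> hw; apply: (le_trans (ler_wpM2l m0 hw)).
  have -> : m * (rho / (2 * (m + 1))) ^+ 2 =
      (rho ^+ 2 / 2) * (m / (2 * (m + 1) ^+ 2)).
    by field; rewrite lt0r_neq0// ltr_wpDl.
  rewrite ler_piMr ?divr_ge0 ?sqr_ge0// ler_pdivrMr ?mul1r; last first.
    by rewrite mulr_gt0// exprn_gt0// ltr_wpDl.
  by nra.
have a2 : 2^-1 <= bump_arg (chart i y).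
  rewrite /bump_arg -/w; have : sqnorm w / rho ^+ 2 <= 2^-1.
    by rewrite ler_pdivrMr ?exprn_gt0// mulrC.
  by lra.
rewrite max_r; last by apply: le_trans a2; rewrite invr_ge0.
have -> : (4^-1 : R) = 2^-1 ^+ 2 by field.
by rewrite lerXn2r ?nnegrE ?invr_ge0//; apply: le_trans a2; rewrite invr_ge0.
Qed.

Lemma bump_along_curve c t : (forall t, 0 <= t <= 1 -> C1_at G c t) -> 0 <= t <= 1 ->
  `|bump (c t) - bump (c 0)| <= bump_const * mean (speed G c).
Proof.
move=> hc t01; have z01 : 0 <= (0 : R) <= 1 by rewrite lexx ler01.
have cs : cont_on 0 1 (speed G c) by move=> u /hc; exact: speed_cont.
rewrite -(meanZ _ cs).
apply: (increment_le_mean (F := bump \o c) (f := derive1 (bump \o c)) z01 t01).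
- by move=> u /hc/bump_curve[/C1_pt_is_derive].
- by move=> u /hc/bump_curve[[]].
- by move=> u u01; exact: (cvgM (@cst_continuous R R bump_const u) (cs u u01)).
- by move=> u /hc/bump_curve[].
Qed.

Lemma bump_localization : exists d e : R, [/\ 0 < d, 0 < e & forall y z, dom i y ->
  `|chart i y - p0| < d ->
  ((rdist G z y < e%:E)%E -> dom i z /\ `|chart i z - p0| <= rho) /\
  forall c, minimal_geodesic G y z c -> (rdist G y z < e%:E)%E ->
    forall t, 0 <= t <= 1 -> dom i (c t) /\ `|chart i (c t) - p0| <= rho].
Proof.
have [d d0 hd] := bump_near_center.
have C0 := bump_const_gt0.
exists d, (bump_const^-1 * 4^-1); split => //; first by rewrite mulr_gt0 ?invr_gt0.
move=> y z dy hy; have hb := hd y dy hy.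
have stay u : `|bump u - bump y| < 4^-1 -> dom i u /\ `|chart i u - p0| <= rho.
  move=> hu; apply: bump_gt0_in; move: hu; rewrite ltr_norml => /andP[h _]; lra.
split=> [hyz|c hc hyz t t01]; apply: stay.
  have h : (bump_const^-1 * `|bump z - bump y| < bump_const^-1 * 4^-1).
    by rewrite -lte_fin; apply: le_lt_trans hyz; rewrite distrC; exact: bump_rdist.
  by move: h; rewrite ltr_pM2l ?invr_gt0.
have [gc c0 _ lc] := hc.
have hC u : 0 <= u <= 1 -> C1_at G c u by move=> u01; exact: geodesic_at_C1 (gc u u01).
rewrite -c0; apply: (le_lt_trans (bump_along_curve hC t01)).
move: hyz; rewrite -lc (C1_curve_length hC) lte_fin => h.
by rewrite -ltr_pdivlMl.
Qed.

End Bump.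

Section Localization.
Variables (R : realType) (n : nat) (M : topologicalType).
Variable G : riemannian_manifold R n M.

(** Along a curve shorter than [e] the bump function cannot drop from near one to
zero, so the curve stays in the chart, close to its center.  The first conclusion
holds because a point at distance less than [e] is joined by such a curve. *)
Lemma chart_localization (i : chart_index G) (p0 : 'rV[R]_n) (rho k L r : R) :
  0 < rho -> 0 < k -> metric_bounds (gram i) p0 rho k L ->
  (forall p, `|p - p0| < rho -> (chart i @` dom i) p) -> 0 < r ->
  exists d e : R, [/\ 0 < d, 0 < e & forall y z, dom i y -> `|chart i y - p0| < d ->
    ((rdist G z y < e%:E)%E -> dom i z /\ `|chart i z - p0| < r) /\
    forall c, minimal_geodesic G y z c -> (rdist G y z < e%:E)%E ->
      forall t, 0 <= t <= 1 -> dom i (c t) /\ `|chart i (c t) - p0| < r].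
Proof.
move=> rho0 k0 mb ball r0; pose s := Num.min (rho / 2) (r / 2).
have s0 : 0 < s by rewrite lt_min !divr_gt0.
have s_rho : s < rho by rewrite gt_min ltr_pdivrMr// ltr_pMr// ltr1n.
have s_r : s < r by rewrite gt_min orbC ltr_pdivrMr// ltr_pMr// ltr1n.
have [d [e [d0 e0 h]]] := @bump_localization R n M G i p0 s k s0 k0
  (fun p hp => ball p (le_lt_trans hp s_rho))
  (fun p v hp => mb_lower mb v (le_lt_trans hp s_rho)).
exists d, e; split => // y z dy hy; have [h1 h2] := h y z dy hy.
split=> [/h1[dz hz]|c hc hyz t t01]; first by split; [exact dz|exact: le_lt_trans s_r].
have [dz hz] := h2 c hc hyz t t01.
by split; [exact dz|exact: le_lt_trans s_r].
Qed.

End Localization.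

(** * The distance in coordinates *)

Section LocalProjection.
Variables (R : realType) (n : nat) (M : topologicalType).
Variable G : riemannian_manifold R n M.
Local Notation V := 'rV[R]_n.
Variables (i : chart_index G) (p0 : V) (rho k L : R).
Hypotheses (rho0 : 0 < rho) (k0 : 0 < k) (L1 : 1 <= L).
Hypothesis mb : metric_bounds (gram i) p0 rho k L.
Hypothesis ballU : forall p, `|p - p0| < rho -> (chart i @` dom i) p.
Implicit Types (p q z : V) (c : R -> M).

Definition chart_dist p q : R := fine (rdist G (chart_inv i p) (chart_inv i q)).

Lemma chart_dist_ge0 p q : 0 <= chart_dist p q.
Proof. by apply: fine_ge0; exact: rdist_ge0. Qed.

Lemma chart_curve_rdist (s : R -> V) : C1_on s ->
  (forall t, 0 <= t <= 1 -> in_ball p0 rho (s t)) ->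
  (rdist G (chart_inv i (s 0%R)) (chart_inv i (s 1%R)) <=
    (mean (fun t => Num.sqrt (energy_density (gram i) s t)))%:E)%E.
Proof. by move=> sC sB; apply: rdist_chart_curve => // t t01; exact/ballU/sB. Qed.

Lemma chart_dist_energy (s : R -> V) : C1_on s ->
  (forall t, 0 <= t <= 1 -> in_ball p0 rho (s t)) ->
  chart_dist (s 0) (s 1) ^+ 2 <= mean (energy_density (gram i) s).
Proof.
move=> sC sB; have := chart_curve_rdist sC sB.
set E := energy_density (gram i) s.
have cE : cont_on 0 1 E := energy_density_cont mb sC sB.
have csE : cont_on 0 1 (fun t => Num.sqrt (E t)).
  move=> t t01; apply: (continuous_comp (f := E) (g := Num.sqrt)); first exact: cE.
  exact: sqrt_continuous.
have -> : mean E = mean (fun t => Num.sqrt (E t) ^+ 2).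
  apply: mean_eq => t t01; rewrite sqr_sqrtr//.
  by apply: le_trans (mb_lower mb _ (sB t t01)); rewrite mulr_ge0 ?sqr_ge0.
move=> h; apply: le_trans (mean_sqr_ge csE).
rewrite lerXn2r ?nnegrE ?chart_dist_ge0//.
  by apply: mean_ge0 => t _; exact: sqrtr_ge0.
have r0 := rdist_ge0 G (chart_inv i (s 0)) (chart_inv i (s 1)).
rewrite -lee_fin /chart_dist fineK// fin_numE.
rewrite gt_eqF ?(lt_le_trans _ r0) ?ltNy0//=.
by rewrite lt_eqF// (le_lt_trans h)// ltry.
Qed.

Lemma chart_rdistE p q : in_ball p0 rho p -> in_ball p0 rho q ->
  rdist G (chart_inv i p) (chart_inv i q) = (chart_dist p q)%:E.
Proof.
move=> hp hq; have sB t : 0 <= t <= 1 -> in_ball p0 rho (p + t *: (q - p)).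
  by move=> t01; exact: in_ball_seg.
have sC : C1_on (fun t => p + t *: (q - p)) by move=> t _; exact: C1_pt_line.
have := chart_curve_rdist sC sB.
rewrite scale0r addr0 scale1r [p + _]addrC subrK => h.
have r0 := rdist_ge0 G (chart_inv i p) (chart_inv i q).
rewrite /chart_dist fineK// fin_numE gt_eqF ?(lt_le_trans _ r0) ?ltNy0//=.
by rewrite lt_eqF// (le_lt_trans h)// ltry.
Qed.

Lemma chart_dist_le p q : in_ball p0 rho p -> in_ball p0 rho q ->
  chart_dist p q <= L * `|q - p|.
Proof.
exact: (dist_le L1 mb chart_dist_ge0 chart_dist_energy).
Qed.

Lemma minimal_geodesic_minimizer (rad : R) p q c : in_ball p0 rho p -> in_ball p0 rho q ->
  minimal_geodesic G (chart_inv i p) (chart_inv i q) c ->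
  (forall t, 0 <= t <= 1 -> dom i (c t) /\ `|chart i (c t) - p0| < rad) ->
  minimizer (gram i) p0 chart_dist rad p q (chart i \o c).
Proof.
move=> hp hq hc hB.
have [iC iE] := minimal_geodesic_chart hc (fun t t01 => (hB t t01).1).
have [_ c0 c1 _] := hc.
split.
- exact iC.
- by rewrite /= c0; exact: (chart_domP (ballU hp)).2.
- by rewrite /= c1; exact: (chart_domP (ballU hq)).2.
- by move=> t /hB[].
- exact iE.
Qed.

End LocalProjection.

(** * Nearest points under uniform midpoint convexity *)

Lemma locally_lipschitz_cont (R : realType) (V : normedModType R) (f : V -> R) (p : V)
    (r C : R) : 0 < r -> 0 <= C ->
  (forall q, `|q - p| < r -> `|f q - f p| <= C * `|q - p|) -> {for p, continuous f}.
Proof.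
move=> r0 C0 h; apply/cvgrPdist_lt => e e0; apply/nbhs_normP.
have C1 : 0 < C + 1 by rewrite ltr_wpDl.
exists (Num.min r (e / (C + 1))); first by rewrite /= lt_min r0 divr_gt0.
move=> q; rewrite /= lt_min distrC => /andP[qr qe].
rewrite distrC; apply: (le_lt_trans (h q qr)).
apply: (@le_lt_trans _ _ ((C + 1) * `|q - p|)).
  by rewrite ler_wpM2r// lerDl.
by rewrite mulrC -ltr_pdivlMr.
Qed.

Section CoordinateProjection.
Variables (R : realType) (n : nat).
Local Notation V := 'rV[R]_n.
Variables (p0 : V) (eta kappa C : R) (T : set V) (d : V -> V -> R).
Hypotheses (eta0 : 0 < eta) (kappa0 : 0 < kappa) (C0 : 0 <= C).
Hypothesis d_ge0 : forall p q, 0 <= d p q.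
Hypothesis Tp0 : T p0.
Hypothesis T_closed : closed [set p | `|p - p0| <= eta / 2 /\ T p].
Hypothesis d_lipschitz : forall (p q p' q' : V) (eps : R),
  in_ball p0 eta p -> in_ball p0 eta q -> in_ball p0 eta p' -> in_ball p0 eta q' ->
  `|p' - p| <= eps -> `|q' - q| <= eps -> eps <= 2 * eta ->
  d p' q' ^+ 2 <= d p q ^+ 2 + C * eps.
Implicit Types (p q y z : V).

Let half_eta : eta / 2 < eta.
Proof. by rewrite ltr_pdivrMr// ltr_pMr// ltr1n. Qed.

Let ball_dist p q : in_ball p0 eta p -> in_ball p0 eta q -> `|q - p| <= 2 * eta.
Proof.
move=> hp hq; have -> : q - p = (q - p0) - (p - p0).
  by apply/matrixP => a b; rewrite !mxE; ring.
rewrite (le_trans (ler_normB _ _))// mulr_natl mulr2n lerD// ltW//.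
Qed.

Lemma nearest_exists y : in_ball p0 eta y ->
  exists2 p, T p /\ `|p - p0| <= eta / 2 &
    forall z, T z -> `|z - p0| <= eta / 2 -> d p y <= d z y.
Proof.
move=> hy; pose K := [set p | `|p - p0| <= eta / 2 /\ T p].
have K0 : K !=set0 by exists p0; split=> //; rewrite subrr normr0 divr_ge0// ltW.
have cK : compact K.
  apply: bounded_closed_compact T_closed.
  exists (eta / 2 + `|p0|); split; first exact: num_real.
  move=> x hx p /= [h _]; rewrite -(subrK p0 p).
  by rewrite (le_trans (ler_normD _ _))// (le_trans _ (ltW hx))// lerD2r.
have KB p : `|p - p0| <= eta / 2 -> in_ball p0 eta p by move=> h; exact: le_lt_trans half_eta.
have cf : {within K, continuous (fun p => d p y ^+ 2)}.
  apply: continuous_in_subspaceT => p /set_mem [/KB hp _].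
  apply: (@locally_lipschitz_cont _ _ _ _ (eta - `|p - p0|) C); rewrite ?subr_gt0//.
  move=> q hqp; have hq : in_ball p0 eta q.
    rewrite /in_ball -(subrKA p).
    by rewrite (le_lt_trans (ler_normD _ _))// -ltrBrDr.
  have yy : `|y - y| <= `|q - p| by rewrite subrr normr0.
  have pq2 : `|q - p| <= 2 * eta by exact: ball_dist.
  have h1 := d_lipschitz hp hy hq hy (lexx _) yy pq2.
  have pq : `|p - q| <= `|q - p| by rewrite distrC.
  have h2 := d_lipschitz hq hy hp hy pq yy pq2.
  by rewrite ler_distlC; apply/andP; split; [rewrite lerBlDr|].
have [p /set_mem [pe Tp] hp] := EVT_min_rV K0 cK cf.
exists p => // z Tz ze; have := hp z (mem_set (conj ze Tz)).
by rewrite ler_pXn2r ?nnegrE ?d_ge0.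
Qed.

Hypothesis midpoint : forall y z1 z2, in_ball p0 eta y ->
  in_ball p0 eta z1 -> in_ball p0 eta z2 -> T z1 -> T z2 ->
  exists m, T m /\
    d m y ^+ 2 <= (d z1 y ^+ 2 + d z2 y ^+ 2) / 2 - kappa * `|z2 - z1| ^+ 2.

Definition minimizes y p := [/\ T p, in_ball p0 eta p & forall z, T z -> d p y <= d z y].

(** Apply [midpoint] to [p] and [q]: the point [m] is not closer to [y] than [p]. *)
Lemma minimizes_growth y p q : in_ball p0 eta y -> minimizes y p -> T q ->
  in_ball p0 eta q -> d p y ^+ 2 + 2 * kappa * `|q - p| ^+ 2 <= d q y ^+ 2.
Proof.
move=> hy [Tp hp pmin] Tq hq; have [m [Tm hm]] := midpoint hy hp hq Tp Tq.
have : d p y ^+ 2 <= d m y ^+ 2 by rewrite lerXn2r ?nnegrE ?d_ge0//; exact: pmin.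
lra.
Qed.

Lemma minimizes_unique y p q : in_ball p0 eta y -> minimizes y p -> T q ->
  in_ball p0 eta q -> d q y <= d p y -> q = p.
Proof.
move=> hy hp Tq hq qp; have hg := minimizes_growth hy hp Tq hq.
have : d q y ^+ 2 <= d p y ^+ 2 by rewrite lerXn2r ?nnegrE ?d_ge0.
move=> h; have : 2 * kappa * `|q - p| ^+ 2 <= 0 by lra.
rewrite pmulr_rle0 ?mulr_gt0// => h2.
have /eqP : `|q - p| ^+ 2 == 0 by rewrite eq_le h2 sqr_ge0.
by move/eqP; rewrite expf_eq0 /= normr_eq0 subr_eq0 => /eqP.
Qed.

(** Add the growth inequalities at [y] and at [y'], each tested on the nearest point
of the other, and use that [d ^+ 2] is Lipschitz in its second argument. *)
Lemma minimizes_holder y y' p p' : in_ball p0 eta y -> in_ball p0 eta y' ->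
  minimizes y p -> minimizes y' p' ->
  2 * kappa * `|p' - p| ^+ 2 <= C * `|y' - y|.
Proof.
move=> hy hy' hp hp'; have [Tp bp _] := hp; have [Tp' bp' _] := hp'.
have h1 := minimizes_growth hy hp Tp' bp'.
have h2 := minimizes_growth hy' hp' Tp bp; rewrite distrC in h2.
have z (u : V) : `|u - u| <= `|y' - y| by rewrite subrr normr0.
have e2 : `|y' - y| <= 2 * eta by exact: ball_dist.
have yy : `|y - y'| <= `|y' - y| by rewrite distrC.
have h3 := d_lipschitz bp' hy' bp' hy (z _) yy e2.
have h4 := d_lipschitz bp hy bp hy' (z _) (lexx _) e2.
lra.
Qed.

End CoordinateProjection.

(** * The projection on a locally convex set *)

Section ProjectionOnLocallyConvexSet.
Variables (R : realType) (n : nat) (M : topologicalType).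
Variable G : riemannian_manifold R n M.
Local Notation V := 'rV[R]_n.
Variable S : set M.
Implicit Types (i : chart_index G) (p q y z : V) (c : R -> M).

Definition chart_trace i p0 (rho : R) : set V :=
  [set p | in_ball p0 rho p /\ S (chart_inv i p)].

Lemma convex_small_ball x (e : R) : 0 < e -> (e%:E <= convexity_radius G x)%E ->
  convex_subset G (mball G x (e / 2)).
Proof.
move=> e0 he; have e2 : e / 2 < e by rewrite ltr_pdivrMr// ltr_pMr// ltr1n.
have : ((e / 2)%:E < convexity_radius G x)%E by apply: lt_le_trans he; rewrite lte_fin.
move=> /ereal_sup_gt[_ [r [_ hr _] <-]]; rewrite lte_fin => er.
apply: hr; first by rewrite divr_gt0.
by move=> y /= hy; apply: lt_trans hy _; rewrite lte_fin.
Qed.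

(** The convexity of small balls provides the minimizing geodesics to arbitrary
points [y]; the convexity of the trace of [S] on a ball provides one that stays in
[S], whose middle is the point [m].  Both kinds stay in the chart by
[chart_localization], whatever the radius of the ball in which they are given. *)
Lemma local_estimates x : S x -> locally_convex_subset G S ->
  let i := chart_at G x in let p0 := chart i x in
  exists rho k L eta : R,
  [/\ [/\ 0 < rho, 0 < k, 1 <= L & 0 < eta],
      metric_bounds (gram i) p0 rho k L,
      forall p, `|p - p0| < rho -> (chart i @` dom i) p,
      eta <= rho / 8 &
      (forall p q p' q' (eps : R), in_ball p0 eta p -> in_ball p0 eta q ->
        `|p' - p| <= eps -> `|q' - q| <= eps -> eps <= 2 * eta ->
        chart_dist (G := G) i p' q' ^+ 2 <=
          chart_dist (G := G) i p q ^+ 2 + perturb_const rho k L * eps) /\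
      (forall y z1 z2, in_ball p0 eta y -> in_ball p0 eta z1 -> in_ball p0 eta z2 ->
        chart_trace i p0 rho z1 -> chart_trace i p0 rho z2 ->
        exists m, chart_trace i p0 rho m /\
          chart_dist (G := G) i m y ^+ 2 <=
            (chart_dist (G := G) i z1 y ^+ 2 + chart_dist (G := G) i z2 y ^+ 2) / 2
            - k ^+ 2 / 16 * `|z2 - z1| ^+ 2)].
Proof.
move=> Sx lcS i p0; have dx : dom i x := chart_atP G x.
have Up0 : (chart i @` dom i) p0 by exists x.
have oU : open (chart i @` dom i) := @codom_open R n M G i.
have gC2 : Ck 2 (chart i @` dom i) (gram i) := @gram_smooth R n M G i 2%N.
have gs p : (chart i @` dom i) p -> (gram i p)^T = gram i p.
  by move=> [y dy <-]; exact: gram_sym.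
have gp p : (chart i @` dom i) p -> forall v : V, v != 0 -> 0 < bil (gram i p) v v.
  by move=> [y dy <-] v v0; exact: gram_pos.
have [k [L [k0 L1 nmb]]] := smooth_metric_bounds oU Up0 gC2 gs gp.
have [rho [rho0 mb ballU]] : exists rho, [/\ 0 < rho,
    metric_bounds (gram i) p0 rho k L &
    forall p, `|p - p0| < rho -> (chart i @` dom i) p].
  near (0 : R)^'+ => rho; exists rho; split.
  - by near: rho; exact: nbhs_right_gt.
  - by near: rho; exact: nmb.
  - by near: rho; exact: open_ballP.
have L0 : 0 < L by exact: lt_le_trans ltr01 L1.
have d0 := @chart_dist_ge0 R n M G i.
have dE := chart_dist_energy mb ballU.
have [delta delta0 hdelta] := midpoint_strict_convexity k0 L1 mb d0 dE rho0.
have rho2 : 0 < rho / 2 by rewrite divr_gt0.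
have [d1 [e1 [d10 e10 loc]]] := chart_localization rho0 k0 mb ballU rho2.
have [e [e0 he hconv]] := lcS x Sx.
have bconv := convex_small_ball e0 he.
(* The last two bounds make any two points of the ball closer than [e1], and each
of them closer to [x] than [e / 2]. *)
have [eta [eta0 eta_delta eta_rho [eta_d1 eta_e1 eta_e]]] : exists eta, [/\ 0 < eta,
    eta <= delta, eta <= rho / 8 & [/\ eta <= d1, L * (2 * eta) < e1 & L * eta < e / 2]].
  near (0 : R)^'+ => eta; exists eta.
  have h1 : 2 * L * eta <= e1 / 2.
    by near: eta; apply: near0_scale; rewrite ?mulr_ge0 ?(ltW L0)// divr_gt0.
  have h2 : L * eta <= e / 4.
    by near: eta; apply: near0_scale; rewrite ?(ltW L0)// divr_gt0.
  split.
  - by near: eta; exact: nbhs_right_gt.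
  - by near: eta; exact: nbhs_right_le.
  - by near: eta; apply: nbhs_right_le; rewrite divr_gt0.
  - split; first by near: eta; exact: nbhs_right_le.
      by clear -h1 e10; lra.
    by clear -h2 e0; lra.
have in_rho p : in_ball p0 eta p -> in_ball p0 rho p.
  by move=> hp; apply: (lt_le_trans hp); lra.
have p0x : chart_inv i p0 = x by exact: chartK.
have p0B : in_ball p0 rho p0 by rewrite /in_ball subrr normr0.
have dist_x p : in_ball p0 eta p -> (rdist G x (chart_inv i p) < (e / 2)%:E)%E.
  move=> hp; rewrite -{1}p0x (chart_rdistE ballU p0B (in_rho _ hp)) lte_fin.
  apply: le_lt_trans eta_e.
  apply: (le_trans (chart_dist_le L1 mb ballU p0B (in_rho _ hp))).
  by rewrite ler_wpM2l ?(ltW L0)// ltW.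
have stay p q c : in_ball p0 eta p -> in_ball p0 eta q ->
    minimal_geodesic G (chart_inv i p) (chart_inv i q) c ->
    forall t, 0 <= t <= 1 -> dom i (c t) /\ `|chart i (c t) - p0| < rho / 2.
  move=> hp hq hc; have [dp ep] := chart_domP (ballU _ (in_rho _ hp)).
  have hpd : `|chart i (chart_inv i p) - p0| < d1 by rewrite ep; exact: lt_le_trans eta_d1.
  apply: (loc _ (chart_inv i q) dp hpd).2; first exact hc.
  rewrite (chart_rdistE ballU (in_rho _ hp) (in_rho _ hq)) lte_fin.
  apply: (le_lt_trans (chart_dist_le L1 mb ballU (in_rho _ hp) (in_rho _ hq))).
  apply: le_lt_trans eta_e1; rewrite ler_wpM2l ?(ltW L0)//.
  have -> : q - p = (q - p0) - (p - p0) by apply/matrixP => a b; rewrite !mxE; ring.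
  by rewrite (le_trans (ler_normB _ _))// mulr_natl mulr2n lerD// ltW.
have geo p q : in_ball p0 eta p -> in_ball p0 eta q ->
    exists s, minimizer (gram i) p0 (chart_dist (G := G) i) (rho / 2) p q s.
  move=> hp hq; have [c [hc _] _] := bconv _ _ (dist_x p hp) (dist_x q hq).
  exists (chart i \o c).
  exact: (minimal_geodesic_minimizer ballU (in_rho _ hp) (in_rho _ hq) hc (stay _ _ _ hp hq hc)).
exists rho, k, L, eta; split => //; split.
  move=> p q p' q' eps hp hq ep eq eeta; have [s hs] := geo p q hp hq.
  exact: (dist_sqr_perturb k0 L1 mb d0 dE rho0 eta_rho hp hq hs ep eq eeta).
move=> y z1 z2 hy h1 h2 [_ S1] [_ S2].
have in_delta p : in_ball p0 eta p -> in_ball p0 delta p.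
  by move=> hp; exact: lt_le_trans eta_delta.
have e2 : e / 2 < e by rewrite ltr_pdivrMr// ltr_pMr// ltr1n.
have inS z : in_ball p0 eta z -> S (chart_inv i z) -> (S `&` mball G x e) (chart_inv i z).
  by move=> hz Sz; split=> //; apply: lt_trans (dist_x z hz) _; rewrite lte_fin.
have [c [hc cS] _] := hconv _ _ (inS _ h1 S1) (inS _ h2 S2).
have hstay := stay _ _ _ h1 h2 hc.
have cm := minimal_geodesic_minimizer ballU (in_rho _ h1) (in_rho _ h2) hc hstay.
have [a1 ha1] := geo z1 y h1 hy; have [a2 ha2] := geo z2 y h2 hy.
have half01 : 0 <= (2^-1 : R) <= 1 by rewrite invr_ge0 invf_le1 ?ler1n ?ler0n.
exists ((chart i \o c) 2^-1); split; last first.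
  exact: (hdelta y z1 z2 a1 a2 _ (in_delta _ hy) (in_delta _ h1) (in_delta _ h2) ha1 ha2 cm).
have [dm hm] := hstay _ half01.
split.
  by apply: (lt_le_trans hm); rewrite ler_pdivrMr// ler_peMr ?ler1n// ltW.
rewrite /= chartK//; suff [] : (S `&` mball G x e) (c 2^-1) by [].
by apply: cS; exists 2^-1 => //=; rewrite in_itv.
Unshelve. all: by end_near. Qed.

End ProjectionOnLocallyConvexSet.

Section LocalProjectionMap.
Variables (R : realType) (n : nat) (M : topologicalType).
Variable G : riemannian_manifold R n M.
Local Notation V := 'rV[R]_n.
Variable S : set M.
Hypothesis S_closed : closed S.
Implicit Types (i : chart_index G) (p q z : V).

Lemma chart_trace_closed i p0 (rho r : R) : r < rho ->
  (forall p, `|p - p0| < rho -> (chart i @` dom i) p) ->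
  closed [set p | `|p - p0| <= r /\ chart_trace S i p0 rho p].
Proof.
move=> r_rho ballU p clp.
have cball : closed [set p : V | `|p - p0| <= r].
  have -> : [set p : V | `|p - p0| <= r] = (fun p : V => `|p - p0|) @^-1` [set x | x <= r] by [].
  apply: closed_comp; last exact: closed_le.
  move=> q _; apply: (@locally_lipschitz_cont _ _ _ _ 1 1) => // u _.
  rewrite mul1r; have -> : u - q = (u - p0) - (q - p0).
    by apply/matrixP => a b; rewrite !mxE; ring.
  exact: ler_dist_dist.
have pr : `|p - p0| <= r.
  by apply: cball; move: clp; apply: closure_subset => q [].
have prho : `|p - p0| < rho by exact: le_lt_trans r_rho.
split=> //; split=> //; apply: S_closed => B nB.
have := chart_inv_cont (ballU p prho) nB.
by move=> /clp[q [[_ [_ Sq]] Bq]]; exists (chart_inv i q).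
Qed.

Lemma rdist_set_attained (y z : M) : S z -> (forall w, S w -> (rdist G z y <= rdist G w y)%E) ->
  rdist_set G S y = rdist G z y.
Proof.
move=> Sz hz; apply/eqP; rewrite eq_le; apply/andP; split.
  by apply: ereal_inf_lbound; exists z.
by apply: le_ereal_inf_tmp => _ [w Sw <-]; exact: hz.
Qed.

(** Points of [S] that are not in the small coordinate ball are farther from [y]
than [x] is, so a nearest point among those of the ball is a nearest point. *)
Lemma local_projection x : S x -> locally_convex_subset G S ->
  exists W : set M, [/\ open W, W x,
    forall y : M, W y -> exists z : M, metric_proj G S y = [set z] &
    forall pr : M -> M, (forall y : M, W y -> metric_proj G S y = [set pr y]) ->
      forall y : M, W y -> {for y, continuous pr}].
Proof.
move=> Sx lcS; have := local_estimates Sx lcS.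
set i := chart_at G x; set p0 := chart i x.
move=> [rho [k [L [eta [[rho0 k0 L1 eta0] mb ballU eta_rho [lip mid]]]]]].
have dx : dom i x := chart_atP G x.
pose T := chart_trace S i p0 rho; pose d := chart_dist (G := G) i.
pose C := perturb_const rho k L; pose kappa := k ^+ 2 / 16.
have C0 : 0 <= C by exact: perturb_const_ge0.
have kappa0 : 0 < kappa by rewrite divr_gt0// exprn_gt0.
have L0 : 0 < L by exact: lt_le_trans ltr01 L1.
have eta_rho' : eta < rho by apply: (le_lt_trans eta_rho); lra.
have half_eta : eta / 2 < eta by rewrite ltr_pdivrMr// ltr_pMr// ltr1n.
have d0 p q : 0 <= d p q by exact: chart_dist_ge0.
have p0x : chart_inv i p0 = x by exact: chartK.
have in_rho p : in_ball p0 eta p -> in_ball p0 rho p.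
  by move=> hp; exact: lt_trans eta_rho'.
have p0eta : in_ball p0 eta p0 by rewrite /in_ball subrr normr0.
have Tp0 : T p0 by split; [exact: in_rho|rewrite p0x].
have Tcl : closed [set p | `|p - p0| <= eta / 2 /\ T p].
  by apply: chart_trace_closed ballU; exact: lt_trans half_eta eta_rho'.
have dlip p q p' q' (eps : R) : in_ball p0 eta p -> in_ball p0 eta q ->
    in_ball p0 eta p' -> in_ball p0 eta q' ->
    `|p' - p| <= eps -> `|q' - q| <= eps -> eps <= 2 * eta ->
    d p' q' ^+ 2 <= d p q ^+ 2 + C * eps.
  by move=> hp hq _ _ e1 e3 e4; exact: (lip _ _ _ _ _ hp hq e1 e3 e4).
have [d2 [e2 [d20 e20 loc]]] := chart_localization rho0 k0 mb ballU (divr_gt0 eta0 (ltr0n _ 2)).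
(* Points of [W] are closer to [x] than [e2], the scale of [loc]. *)
have [theta [theta0 theta_d theta_eta theta_e]] : exists theta,
    [/\ 0 < theta, theta <= d2, theta <= eta & L * theta <= e2 / 2].
  near (0 : R)^'+ => theta; exists theta; split.
  - by near: theta; exact: nbhs_right_gt.
  - by near: theta; exact: nbhs_right_le.
  - by near: theta; exact: nbhs_right_le.
  - by near: theta; apply: near0_scale; rewrite ?(ltW L0)// divr_gt0.
have e22 : e2 / 2 < e2 by rewrite ltr_pdivrMr// ltr_pMr// ltr1n.
pose W := [set y | dom i y /\ `|chart i y - p0| < theta].
have W_eta (y : M) : W y -> in_ball p0 eta (chart i y).
  by move=> [_ h]; exact: lt_le_trans theta_eta.
have key (y : M) : W y -> exists p, minimizes p0 eta T d (chart i y) p /\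
    metric_proj G S y = [set chart_inv i p].
  move=> Wy; have [dy hy] := Wy; have qeta := W_eta y Wy.
  set q := chart i y in hy qeta *.
  have qy : chart_inv i q = y by exact: chartK.
  have locz := (loc y _ dy (lt_le_trans hy theta_d)).
  have [p [Tp pe] pmin] := nearest_exists eta0 C0 d0 Tp0 Tcl dlip qeta.
  have peta : in_ball p0 eta p by exact: le_lt_trans half_eta.
  have dE z : in_ball p0 rho z -> rdist G (chart_inv i z) y = (d z q)%:E.
    by move=> hz; have := chart_rdistE ballU hz (in_rho _ qeta); rewrite qy.
  have small : d p q < e2.
    have hp0 : `|p0 - p0| <= eta / 2 by rewrite subrr normr0 divr_ge0// ltW.
    apply: (le_lt_trans (pmin p0 Tp0 hp0)); apply: le_lt_trans e22.
    apply: le_trans theta_e; have p0r := in_rho _ p0eta.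
    apply: (le_trans (chart_dist_le L1 mb ballU p0r (in_rho _ qeta))).
    by rewrite ler_wpM2l ?(ltW L0)// ltW.
  have near_pt w : S w -> (rdist G w y < e2%:E)%E ->
      exists z, [/\ chart_inv i z = w, T z & `|z - p0| < eta / 2].
    move=> Sw /(locz w).1[dw hw]; exists (chart i w).
    have ww : chart_inv i (chart i w) = w by exact: chartK.
    split=> //; split; last by rewrite ww.
    exact: lt_trans (lt_trans hw half_eta) eta_rho'.
  have glob w : S w -> (rdist G (chart_inv i p) y <= rdist G w y)%E.
    move=> Sw; have [hw|hw] := ltP (rdist G w y) e2%:E; last first.
      by apply: le_trans hw; rewrite dE ?lee_fin ?(ltW small)//; case: Tp.
    have [z [<- Tz ze]] := near_pt w Sw hw.
    rewrite !dE ?lee_fin; [|by case: Tz|by case: Tp].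
    by apply: pmin => //; exact: ltW.
  have Sp : S (chart_inv i p) by case: Tp.
  have dS := rdist_set_attained Sp glob.
  have pm : minimizes p0 eta T d q p.
    split=> // z Tz; have [zr Sz] := Tz.
    by have := glob _ Sz; rewrite !dE ?lee_fin//; case: Tp.
  exists p; split=> //; apply/seteqP; split=> [w [Sw hw]|w ->]; last by split.
  move: hw; rewrite dS => hw.
  have hwe : (rdist G w y < e2%:E)%E by rewrite hw dE ?lte_fin//; case: Tp.
  have [z [zw Tz ze]] := near_pt w Sw hwe.
  have zeta : in_ball p0 eta z by exact: lt_trans ze half_eta.
  rewrite -zw /=; congr (chart_inv i _).
  apply: (minimizes_unique kappa0 d0 mid qeta pm Tz zeta).
  have zr : in_ball p0 rho z by case: Tz.
  have pr : in_ball p0 rho p by case: Tp.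
  by move: hw; rewrite -zw (dE z zr) (dE p pr) => -[->].
have oW : open W.
  rewrite openE => y Wy; have [dy hy] := Wy.
  have h1 : \forall u \near y, dom i u.
    by apply: open_nbhs_nbhs; split; [exact: dom_open|].
  have h2 : \forall u \near y, `|chart i u - p0| < theta.
    have hd : 0 < theta - `|chart i y - p0| by rewrite subr_gt0.
    have /cvgrPdist_lt/(_ _ hd) := chart_continuous dy.
    apply: filterS => u hu; rewrite -(subrKA (chart i y)).
    by rewrite (le_lt_trans (ler_normD _ _))// distrC -ltrBrDr.
  by apply: filterS2 h1 h2 => u.
exists W; split.
- exact oW.
- by split=> //; rewrite subrr normr0.
- by move=> y /key[p [_ ->]]; exists (chart_inv i p).
move=> pr hpr y Wy; pose P u := chart i (pr u).
have hP (u : M) : W u -> minimizes p0 eta T d (chart i u) (P u) /\ pr u = chart_inv i (P u).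
  move=> Wu; have [p [pm pE]] := key u Wu.
  have : [set pr u] (chart_inv i p) by rewrite -(hpr u Wu) pE.
  move=> /= e; have [_ hp _] := pm.
  have [dp ep] := chart_domP (ballU _ (in_rho _ hp)).
  by rewrite /P -e ep.
have Wnear : \forall u \near y, W u by apply: open_nbhs_nbhs.
have cP : {for y, continuous P}.
  apply/cvgrPdist_lt => e e0.
  have r0 : 0 < 2 * kappa * e ^+ 2 / (C + 1).
    by rewrite divr_gt0 ?mulr_gt0 ?exprn_gt0// ltr_wpDl.
  have /cvgrPdist_lt/(_ _ r0) hc := chart_continuous Wy.1.
  apply: filterS2 Wnear hc => u Wu hu; rewrite distrC.
  have hh := minimizes_holder d0 dlip mid (W_eta y Wy) (W_eta u Wu)
    (hP y Wy).1 (hP u Wu).1.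
  rewrite ltNge; apply/negP => eP.
  have h1 : 2 * kappa * e ^+ 2 <= 2 * kappa * `|P u - P y| ^+ 2.
    apply: ler_wpM2l; first by rewrite mulr_ge0// ltW.
    by rewrite lerXn2r ?nnegrE ?(ltW e0).
  have h2 : (C + 1) * `|chart i u - chart i y| < 2 * kappa * e ^+ 2.
    by rewrite mulrC -ltr_pdivlMr ?ltr_wpDl// distrC.
  have h3 : C * `|chart i u - chart i y| <= (C + 1) * `|chart i u - chart i y|.
    by rewrite ler_wpM2r// lerDl ler01.
  by have := le_lt_trans (le_trans (le_trans h1 hh) h3) h2; rewrite ltxx.
have e : \forall u \near y, pr u = (chart_inv i \o P) u.
  by apply: filterS Wnear => u /hP[_ ->] /=; rewrite /P.
apply: (cont_near_eq e); apply: (continuous_comp cP).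
have [_ hp _] := (hP y Wy).1.
exact: chart_inv_cont (ballU _ (in_rho _ hp)).
Unshelve. all: by end_near. Qed.

End LocalProjectionMap.

Theorem corollary2p11 (R : realType) (n : nat) (M : topologicalType)
  (G : riemannian_manifold R n M) (S : set M) :
  complete_manifold G -> closed S -> locally_convex_subset G S ->
  exists W : set M, [/\ open W, S `<=` W &
    exists p : M -> M,
      (forall y, W y -> metric_proj G S y = [set p y]) /\
      {within W, continuous p}].
Proof.
move=> _ clS lcS.
pose Wx x := if pselect (S x) is left Sx
  then sval (cid (local_projection clS Sx lcS)) else set0.
have WxP x (Sx : S x) : [/\ open (Wx x), Wx x x,
    forall y, Wx x y -> exists z, metric_proj G S y = [set z] &
    forall pr : M -> M, (forall y, Wx x y -> metric_proj G S y = [set pr y]) ->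
      forall y, Wx x y -> {for y, continuous pr}].
  rewrite /Wx; case: pselect => // Sx'.
  exact: (svalP (cid (local_projection clS Sx' lcS))).
exists (\bigcup_(x in S) Wx x); split.
- by apply: bigcup_open => x /WxP[].
- by move=> x Sx; exists x => //; have [] := WxP x Sx.
pose p y := xget y (metric_proj G S y).
have hp y : (\bigcup_(x in S) Wx x) y -> metric_proj G S y = [set p y].
  move=> [x Sx Wy]; have [_ _ h _] := WxP x Sx; have [z hz] := h y Wy.
  have : metric_proj G S y (p y) by apply: (xgetPex y); exists z; rewrite hz.
  by rewrite hz => /= ->.
exists p; split; first exact: hp.
apply: continuous_in_subspaceT => y /set_mem [x Sx Wy].
have [_ _ _ h] := WxP x Sx; apply: h Wy => u Wu.
by apply: hp; exists x.
Qed.
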